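(* Let $K$ be a field, $S=K[x_1,\dots,x_n]$, $A\subseteq\{1,\dots,n\}$, $f=\prod_{i\in A}x_i$, and let $J\subset I\subset S_f$ be monomial ideals. Then $I/J$ admits a filtration $$0=M_0\subset M_1\subset\cdots\subset M_r=I/J$$ of $\mathbb Z^n$-graded $S_f$-submodules such that $M_i/M_{i-1}\cong (S_f/P_i)(-a_i)$ for $i=1,\dots,r$, where $\{P_1,\dots,P_r\}$ is a set of $\mathbb Z^n$-graded prime ideals of $S_f$ containing all minimal prime ideals of $I/J$, and $a_i\in\mathbb N^n$ with $a_i(j)=0$ for $j\in A$. Moreover $$H_{I/J}(t)=\sum_{i=1}^rH_{(S_f/P_i)(-a_i)}(t)\quad\text{and}\quad H_{(S_f/P_i)(-a_i)}(t)=\frac{Q_i(t)(1+t)^{|A|}}{(1-t)^{d_i}},$$ where $d_i=\dim S_f/P_i$ and $Q_i(t)$ is a polynomial with $Q_i(1)=1$. In particular $H_{I/J}(t)=Q(t)/(1-t)^d$ with $Q(1)=k\cdot 2^{|A|}$, where $d=\dim I/J$ and $k=|\{i:\dim S_f/P_i=d\}|$.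
   Context: $S_f=K[x_1,\dots,x_n,x_j^{-1}:j\in A]$, $\mathbb Z^n$-graded with the monomial $x^a$ of degree $a$ (monomials: $a_j\in\mathbb Z$ for $j\in A$, $a_j\in\mathbb N$ otherwise). Monomial ideals are ideals generated by monomials; $I/J$ has $K$-basis the monomials in $I\setminus J$. For a $\mathbb Z^n$-graded $K$-vector space $M=\bigoplus_aM_a$ with $\dim_KM_a<\infty$, set $|a|=\sum_j|a_j|$, $M_d=\bigoplus_{|a|=d}M_a$ for $d\in\mathbb N$, $H(M,d)=\dim_KM_d$, $H_M(t)=\sum_{d\ge0}H(M,d)t^d$. $M(-a)$ denotes the shifted module with $M(-a)_b=M_{b-a}$. *)

(* Defs.v *)
From HB Require Import structures.
From mathcomp Require Import all_boot all_order all_algebra.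
From mathcomp Require Import finmap.
From mathcomp Require Import boolp.

Set Implicit Arguments.
Unset Strict Implicit.
Unset Printing Implicit Defensive.

Import GRing.Theory Num.Theory.
Local Open Scope fset_scope.
Local Open Scope ring_scope.

Definition expo (n : nat) := {ffun 'I_n -> int}.

Section Sf.
Variables (n : nat) (K : fieldType) (A : {set 'I_n}).

Definition eadd (a b : expo n) : expo n := [ffun j => a j + b j].
Definition esub (a b : expo n) : expo n := [ffun j => a j - b j].
Definition ezero : expo n := [ffun => 0].

(* x^a is a monomial of S_f = K[x_1..x_n, x_j^-1 : j in A] *)
Definition is_monom (a : expo n) : bool := [forall j, (j \notin A) ==> (0 <= a j)].

Definition deg1 (a : expo n) : nat := (\sum_(j < n) `|a j|)%N.

(* Elements of the Laurent-type algebra: finitely supported K-valued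
   functions on Z^n (coefficient of x^a); S_f = those supported on
   monomials of S_f. *)
Definition elt := {fsfun expo n -> K with 0}.

Definition in_Sf (g : elt) : Prop := forall a, a \in finsupp g -> is_monom a.

Definition elt0 : elt := [fsfun].
Definition eplus (g h : elt) : elt :=
  [fsfun c in finsupp g `|` finsupp h => g c + h c].
Definition etimes (g h : elt) : elt :=
  [fsfun c in [fset eadd a b | a in finsupp g, b in finsupp h] =>
     \sum_(a <- finsupp g) \sum_(b <- finsupp h)
        (if eadd a b == c then g a * h b else 0)].
Definition mono (a : expo n) : elt := [fsfun c in [fset a] => 1].

Definition is_ideal (P : elt -> Prop) : Prop :=
  [/\ forall g, P g -> in_Sf g,
      P elt0,
      forall g h, P g -> P h -> P (eplus g h) &
      forall g h, in_Sf g -> P h -> P (etimes g h)].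

Definition is_prime (P : elt -> Prop) : Prop :=
  [/\ is_ideal P, ~ P (mono ezero) &
      forall g h, in_Sf g -> in_Sf h -> P (etimes g h) -> P g \/ P h].

Definition subI (P Q : elt -> Prop) : Prop := forall g, P g -> Q g.
Definition eqI (P Q : elt -> Prop) : Prop := forall g, P g <-> Q g.
Definition strictI (P Q : elt -> Prop) : Prop :=
  subI P Q /\ exists g, Q g /\ ~ P g.

Definition gen_ideal (D : expo n -> Prop) (g : elt) : Prop :=
  forall P, is_ideal P -> (forall a, D a -> is_monom a -> P (mono a)) -> P g.

(* Krull dimension of S_f / P : supremum of lengths of chains of prime
   ideals of S_f containing P (= prime ideals of S_f/P). *)
Definition prime_chain (P : elt -> Prop) (Q : nat -> elt -> Prop) (l : nat) :=
  [/\ subI P (Q 0%N),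
      forall i, (i <= l)%N -> is_prime (Q i) &
      forall i, (i < l)%N -> strictI (Q i) (Q i.+1)].

Definition krull_dim_quot (P : elt -> Prop) (d : nat) : Prop :=
  (exists Q, prime_chain P Q d) /\ ~ (exists Q, prime_chain P Q d.+1).

(* annihilator of I/J, minimal primes of I/J, dim I/J = dim S_f/Ann(I/J) *)
Definition ann (I J : expo n -> Prop) (g : elt) : Prop :=
  in_Sf g /\ forall h, gen_ideal I h -> gen_ideal J (etimes g h).

Definition min_prime (I J : expo n -> Prop) (Q : elt -> Prop) : Prop :=
  [/\ is_prime Q, subI (ann I J) Q &
      forall Q', is_prime Q' -> subI (ann I J) Q' -> subI Q' Q -> subI Q Q'].

(* Z^n-graded modules with a monomial K-basis, described by the set of
   degrees c whose graded piece is K x^c (all other pieces are 0):   *)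
Definition quot_supp (I J : expo n -> Prop) (c : expo n) : Prop :=
  [/\ is_monom c, gen_ideal I (mono c) & ~ gen_ideal J (mono c)].
(* (S_f/P)(-a) : degree c piece is (S_f/P)_{c-a} *)
Definition shift_quot_supp (P : expo n -> Prop) (a : expo n) (c : expo n) : Prop :=
  is_monom (esub c a) /\ ~ gen_ideal P (mono (esub c a)).

(* graded S_f-isomorphism between two such modules (x^b acts on the basis
   vector e_c by e_c |-> e_{c+b} if c+b is in the support, 0 otherwise):
   a degree-preserving bijection (nonzero scalar on each 1-dim piece)
   commuting with multiplication by the monomials of S_f. *)
Definition mon_iso (D1 D2 : expo n -> Prop) : Prop :=
  exists phi : expo n -> K,
    [/\ forall c, D1 c <-> D2 c,
        forall c, D1 c -> phi c != 0 &
        forall c b, D1 c -> is_monom b -> D1 (eadd c b) ->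
                    phi (eadd c b) = phi c].

End Sf.

(* Hilbert function of a graded module with monomial basis indexed by D:
   H(d) = #{ c in D : |c| = d }  (each c with |c| = d has |c_j| <= d). *)
Definition embed (n d : nat) (v : {ffun 'I_n -> 'I_(d.*2.+1)}) : expo n :=
  [ffun j => (v j)%:Z - d%:Z].

Definition hilb (n : nat) (D : expo n -> Prop) (d : nat) : nat :=
  #|[set v : {ffun 'I_n -> 'I_(d.*2.+1)} |
        `[< D (embed v) /\ deg1 (embed v) = d >] ]|.

(* identity of formal power series  p(t) * sum_d H(d) t^d = q(t) *)
Definition ser_eq (p : {poly int}) (H : nat -> nat) (q : {poly int}) : Prop :=
  forall m : nat, \sum_(k < m.+1) p`_k * (H (m - k)%N)%:Z = q`_m.

(* Main.v *)
Require Import Defs.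
From HB Require Import structures.
From mathcomp Require Import all_boot all_order all_algebra.
From mathcomp Require Import finmap boolp zify.
Import Order.TTheory GRing.Theory Num.Theory.
Local Open Scope ring_scope.
Set Implicit Arguments.
Unset Strict Implicit.
Unset Printing Implicit Defensive.

(** An ideal generated by monomials is determined by the upward closed set of
exponents of its monomials, so the filtration is a chain of such sets between
those of J and I.  If x^c lies in I but not in J and the colon ideal (J : x^c)
is maximal among such, then it is generated by the variables x_j, j in Z, for
some Z disjoint from A; adding x^c to J is one step of the filtration, and
Dickson's lemma makes the process stop.

The dimension of S_f / (x_j : j in Z) is n - |Z|.  The chain sending the other
variables one by one to 0 (or to 1, when invertible) gives one inequality.
Conversely, given primes Q_0 < ... < Q_l, choose x_i in Q_(i+1) but not in Q_i.
If l > n - |Z|, counting monomials in a box yields a polynomial relation between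
the x_i modulo (x_j : j in Z), and its lexicographically smallest monomial
forces a nonzero constant into Q_l.

The Hilbert series of each factor is a product of n series in one variable. *)

(** * The Laurent polynomial ring *)

Section LaurentRing.
Variables (n : nat) (K : fieldType).
Implicit Types (a b c : expo n) (g h : elt n K) (k : K).

Lemma eaddE a b : eadd a b = a + b.
Proof. by apply/ffunP => j; rewrite !ffunE. Qed.

Lemma esubE a b : esub a b = a - b.
Proof. by apply/ffunP => j; rewrite !ffunE. Qed.

Lemma ezeroE : ezero n = 0.
Proof. by apply/ffunP => j; rewrite !ffunE. Qed.

Lemma eplusE g h c : eplus g h c = g c + h c.
Proof.
rewrite fsfunE inE !mem_finsupp.
by case: eqP => [->|//]; case: eqP => [->|//]; rewrite addr0.
Qed.

Lemma elt0E c : elt0 n K c = 0.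
Proof. by rewrite fsfun0E. Qed.

Definition eopp g : elt n K := [fsfun c in finsupp g => - g c].

Lemma eoppE g c : eopp g c = - g c.
Proof. by rewrite fsfunE mem_finsupp; case: eqP => // ->; rewrite oppr0. Qed.

Definition escale k g : elt n K := [fsfun c in finsupp g => k * g c].

Lemma escaleE k g c : escale k g c = k * g c.
Proof. by rewrite fsfunE mem_finsupp; case: eqP => // ->; rewrite mulr0. Qed.

Fact eplusA : associative (@eplus n K).
Proof. by move=> f g h; apply/fsfunP => c; rewrite !eplusE addrA. Qed.
Fact eplusC : commutative (@eplus n K).
Proof. by move=> g h; apply/fsfunP => c; rewrite !eplusE addrC. Qed.
Fact eplus0 : left_id (elt0 n K) (@eplus n K).
Proof. by move=> g; apply/fsfunP => c; rewrite eplusE elt0E add0r. Qed.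
Fact eplusN : left_inverse (elt0 n K) eopp (@eplus n K).
Proof. by move=> g; apply/fsfunP => c; rewrite eplusE elt0E eoppE addNr. Qed.

HB.instance Definition _ := Choice.on (elt n K).
HB.instance Definition _ :=
  GRing.isZmodule.Build (elt n K) eplusA eplusC eplus0 eplusN.

Lemma ecoef0 c : (0 : elt n K) c = 0. Proof. exact: elt0E. Qed.
Lemma ecoefD g h c : (g + h) c = g c + h c. Proof. exact: eplusE. Qed.

Fact escaleA k l g : escale k (escale l g) = escale (k * l) g.
Proof. by apply/fsfunP => c; rewrite !escaleE mulrA. Qed.
Fact escale1 : left_id 1 escale.
Proof. by move=> g; apply/fsfunP => c; rewrite escaleE mul1r. Qed.
Fact escaleDr : right_distributive escale +%R.
Proof.
by move=> k g h; apply/fsfunP => c; rewrite !(escaleE, ecoefD) mulrDr.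
Qed.
Fact escaleDl g : {morph escale^~ g : k l / k + l}.
Proof.
by move=> k l; apply/fsfunP => c; rewrite !(escaleE, ecoefD) mulrDl.
Qed.

HB.instance Definition _ :=
  GRing.Zmodule_isLmodule.Build K (elt n K) escaleA escale1 escaleDr escaleDl.

Lemma ecoefZ k g c : (k *: g) c = k * g c. Proof. exact: escaleE. Qed.

Section Eval.
Variable V : lmodType K.
Implicit Types F : expo n -> V.

(** The linear map sending each monomial x^a to [F a]. Products and substitutions are both built
    from it, so identities between them reduce to monomials. *)
Definition ev F g : V := \sum_(a <- finsupp g) g a *: F a.

Lemma ev_sub F g (U : {fset expo n}) :
  (finsupp g `<=` U)%fset -> ev F g = \sum_(a <- U) g a *: F a.
Proof.
move=> sub; apply: big_fset_incl => // a _ /fsfun_dflt ->.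
by rewrite scale0r.
Qed.

Lemma eq_ev F F' g : {in finsupp g, F =1 F'} -> ev F g = ev F' g.
Proof. by move=> e; apply: eq_big_seq => a /e ->. Qed.

Lemma ev_is_linear F : linear (ev F).
Proof.
move=> k g h; pose U := (finsupp g `|` finsupp h `|` finsupp (k *: g + h)%R)%fset.
have sg : (finsupp g `<=` U)%fset by rewrite /U -fsetUA fsubsetUl.
have sh : (finsupp h `<=` U)%fset.
  by rewrite /U [(finsupp g `|` _)%fset]fsetUC -fsetUA fsubsetUl.
rewrite (ev_sub F sg) (ev_sub F sh) (ev_sub F (fsubsetUr _ _ : _ `<=` U)%fset).
rewrite scaler_sumr -big_split; apply: eq_bigr => a _.
by rewrite ecoefD ecoefZ scalerDl scalerA.
Qed.

HB.instance Definition _ F :=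
  GRing.isLinear.Build K (elt n K) V *:%R (ev F) (ev_is_linear F).

Lemma ev_mono F a : ev F (mono K a) = F a.
Proof.
rewrite (@ev_sub _ _ [fset a]%fset); last exact: finsupp_sub.
by rewrite big_seq_fset1 fsfunE inE eqxx scale1r.
Qed.

End Eval.

Lemma monoE a c : mono K a c = (a == c)%:R.
Proof. by rewrite fsfunE inE eq_sym; case: eqP. Qed.

Lemma ev_id g : ev (mono K) g = g.
Proof.
apply/fsfunP => c; rewrite /ev.
have -> (s : seq (expo n)) : (\sum_(a <- s) g a *: mono K a) c =
    \sum_(a <- s) g a * (a == c)%:R.
  elim: s => [|a s IH]; first by rewrite !big_nil ecoef0.
  by rewrite !big_cons ecoefD ecoefZ monoE IH.
have [cg|cg] := boolP (c \in finsupp g); last first.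
  rewrite (fsfun_dflt cg) big_seq big1 // => a ag; case: eqP => [e|]; last by rewrite mulr0.
  by rewrite -e ag in cg.
rewrite (big_fsetD1 c) //= eqxx mulr1 big_seq big1 ?addr0 // => a.
by rewrite !inE => /andP[/negPf-> _]; rewrite mulr0.
Qed.

Lemma ecoef_ev F g c : (ev F g : elt n K) c = \sum_(a <- finsupp g) g a * F a c.
Proof.
rewrite /ev; elim: (enum_fset _) => [|a s IH]; first by rewrite !big_nil ecoef0.
by rewrite !big_cons ecoefD ecoefZ IH.
Qed.

Lemma ev_comp (V : lmodType K) (F : expo n -> V) (G : expo n -> elt n K) g :
  ev F (ev G g) = ev (fun a => ev F (G a)) g.
Proof. by rewrite [ev G g]/ev linear_sum; apply: eq_bigr => a _; rewrite linearZ. Qed.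

(** Turns the convolution product into the bilinear extension of addition of exponents; the ring
    axioms then come from the group of exponents. *)
Lemma etimesE g h : etimes g h = ev (fun a => ev (fun b => mono K (a + b)) h) g.
Proof.
apply/fsfunP => c; rewrite ecoef_ev.
under [RHS]eq_bigr do rewrite ecoef_ev mulr_sumr.
rewrite fsfunE; case: ifPn => [_|cN].
  apply: eq_bigr => a _; apply: eq_bigr => b _.
  by rewrite eaddE monoE; case: eqP => _; rewrite ?mulr1 ?mulr0.
rewrite big_seq big1 // => a ag; rewrite big_seq big1 // => b bh.
rewrite monoE; case: eqP => [e|]; last by rewrite !mulr0.
case/negP: cN; apply/imfset2P.
by exists a => //; exists b => //; rewrite eaddE.
Qed.

Lemma ev_times (V : lmodType K) (F : expo n -> V) g h :
  ev F (etimes g h) = ev (fun a => ev (fun b => F (a + b)) h) g.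
Proof.
rewrite etimesE ev_comp; apply: eq_ev => a _.
by rewrite ev_comp; apply: eq_ev => b _; rewrite ev_mono.
Qed.

Fact etimesA : associative (@etimes n K).
Proof.
move=> f g h; rewrite -[LHS]ev_id -[RHS]ev_id !ev_times.
apply: eq_ev => a _; rewrite !ev_times.
apply: eq_ev => b _; apply: eq_ev => c _.
by rewrite addrA.
Qed.

Fact etimesC : commutative (@etimes n K).
Proof.
move=> g h; rewrite !etimesE /ev.
under eq_bigr do rewrite scaler_sumr.
under [RHS]eq_bigr do rewrite scaler_sumr.
rewrite exchange_big; apply: eq_bigr => a _; apply: eq_bigr => b _.
by rewrite !scalerA mulrC addrC.
Qed.

Fact etimes1 : left_id (mono K (ezero n)) (@etimes n K).
Proof.
move=> g; rewrite etimesE ev_mono -[RHS]ev_id.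
by apply: eq_ev => b _; rewrite ezeroE add0r.
Qed.

Fact etimesDl : left_distributive (@etimes n K) +%R.
Proof. by move=> f g h; rewrite !etimesE linearD. Qed.

Fact mono0_neq0 : mono K (ezero n) != 0.
Proof.
apply/eqP => /fsfunP/(_ (ezero n)) /eqP.
by rewrite monoE eqxx ecoef0 oner_eq0.
Qed.

HB.instance Definition _ := GRing.Zmodule_isComNzRing.Build (elt n K)
  etimesA etimesC etimes1 etimesDl mono0_neq0.

Lemma etimes_mul g h : etimes g h = g * h. Proof. by []. Qed.
Lemma eplus_add g h : eplus g h = g + h. Proof. by []. Qed.
Lemma elt0_zero : elt0 n K = 0. Proof. by []. Qed.
Lemma mono_ezero : mono K (ezero n) = 1. Proof. by []. Qed.

Lemma mono0 : mono K 0 = 1 :> elt n K. Proof. by rewrite -ezeroE. Qed.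

Lemma monoD a b : mono K (a + b) = mono K a * mono K b.
Proof. by rewrite -etimes_mul etimesE !ev_mono. Qed.

Lemma mulE g h : g * h = ev (fun a => ev (fun b => mono K (a + b)) h) g.
Proof. exact: etimesE. Qed.

Lemma evM (V : lmodType K) (F : expo n -> V) g h :
  ev F (g * h) = ev (fun a => ev (fun b => F (a + b)) h) g.
Proof. exact: ev_times. Qed.

Lemma escale_mull k g h : k *: (g * h) = (k *: g) * h.
Proof. by rewrite !mulE linearZ. Qed.

HB.instance Definition _ :=
  GRing.Lmodule_isLalgebra.Build K (elt n K) escale_mull.

HB.instance Definition _ := GRing.Lalgebra_isComAlgebra.Build K (elt n K).

Lemma ecoefM_mono g a c : (g * mono K a) c = g (c - a).
Proof.
rewrite -[in LHS](ev_id g) /ev mulr_suml.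
under eq_bigr do rewrite -scalerAl -monoD.
rewrite -[in RHS](ev_id g) /ev.
elim: (enum_fset _) => [|b s IH]; first by rewrite !big_nil !ecoef0.
by rewrite !big_cons !ecoefD !ecoefZ IH !monoE [b == _]eq_sym subr_eq [c == _]eq_sym.
Qed.

(** Multiplicativity of [F] is asked only on the two supports, because the substitutions below
    respect products only of monomials of S_f. *)
Lemma ev_mul (R : algType K) (F : expo n -> R) g h :
    {in finsupp g & finsupp h, {morph F : a b / a + b >-> a * b}} ->
  ev F (g * h) = ev F g * ev F h.
Proof.
move=> FM; rewrite evM [ev F g]/ev mulr_suml; apply: eq_big_seq => a ag.
rewrite -scalerAl; congr (_ *: _); rewrite mulr_sumr.
by apply: eq_big_seq => b bh; rewrite FM // scalerAr.
Qed.

End LaurentRing.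

(** * Monomial ideals *)

Lemma seq_argmax (T : eqType) (f : T -> int) (s : seq T) :
  s != [::] -> exists2 x, x \in s & {in s, forall y, f y <= f x}.
Proof.
elim: s => // x s IH _; case: s IH => [_|y s /(_ isT)[z zs zmax]].
  by exists x; rewrite ?mem_head // => y; rewrite inE => /eqP->.
have [le|lt] := lerP (f x) (f z).
  exists z; first by rewrite inE zs orbT.
  by move=> t; rewrite inE => /predU1P[->|/zmax].
exists x; first exact: mem_head.
move=> t; rewrite inE => /predU1P[->//|/zmax /le_trans]; apply; exact: ltW.
Qed.

(** * Absence of zero divisors *)

Section Domain.
Variables (n : nat) (K : fieldType).

(* The lexicographically largest elements of U and V, found coordinate by
   coordinate. *)
Lemma unique_sum (U V : seq (expo n)) : U != [::] -> V != [::] ->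
  exists u v, [/\ u \in U, v \in V & forall u' v', u' \in U -> v' \in V ->
     u' + v' = u + v -> u' = u /\ v' = v].
Proof.
move=> U0 V0.
(* Invariant: survivors agree on the first k coordinates, and a sum of two survivors splits over [U]
   and [V] only into survivors. *)
have main k : (k <= n)%N -> exists U' V' : seq (expo n),
   [/\ U' != [::] /\ {subset U' <= U}, V' != [::] /\ {subset V' <= V},
       forall u v u' v' : expo n, u \in U' -> v \in V' -> u' \in U -> v' \in V ->
         u' + v' = u + v -> u' \in U' /\ v' \in V',
       forall (u u' : expo n) (j : 'I_n), u \in U' -> u' \in U' -> (j < k)%N -> u j = u' j &
       forall (v v' : expo n) (j : 'I_n), v \in V' -> v' \in V' -> (j < k)%N -> v j = v' j].
  elim: k => [_|k IH kn]; first by exists U, V; split; do ?split.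
  have [U' [V' [[U'0 subU] [V'0 subV] closed agreeU agreeV]]] := IH (ltnW kn).
  pose i := Ordinal kn.
  have [u uU umax] := seq_argmax (fun u : expo n => u i) U'0.
  have [v vV vmax] := seq_argmax (fun u : expo n => u i) V'0.
  exists [seq x : expo n <- U' | x i == u i], [seq x : expo n <- V' | x i == v i]; split.
  - split; last by move=> x; rewrite mem_filter => /andP[_ /subU].
    by apply/eqP => e; have := in_nil u; rewrite -e mem_filter eqxx uU.
  - split; last by move=> x; rewrite mem_filter => /andP[_ /subV].
    by apply/eqP => e; have := in_nil v; rewrite -e mem_filter eqxx vV.
  - move=> x y x' y'; rewrite !mem_filter => /andP[/eqP xi xU] /andP[/eqP yi yV].
    move=> x'U y'V e; have [x'U' y'V'] := closed _ _ _ _ xU yV x'U y'V e.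
    (* Neither summand exceeds its maximum at coordinate i, while their sum is the sum of the
       maxima; so both maxima are attained. *)
    have := umax _ x'U'; have := vmax _ y'V'; move/ffunP/(_ i): e.
    rewrite !ffunE x'U' y'V' /= => e l1 l2.
    move: e l1 l2; rewrite xi yi; move: (x' i) (y' i) (u i) (v i) => p q r s.
    by split; apply/andP; split=> //; apply/eqP; lia.
  - move=> x x' j; rewrite !mem_filter => /andP[/eqP xi xU] /andP[/eqP xi' xU'].
    rewrite ltnS leq_eqVlt => /predU1P[jk|]; last exact: agreeU.
    by rewrite (val_inj (jk : val j = val i)) xi xi'.
  - move=> x x' j; rewrite !mem_filter => /andP[/eqP xi xU] /andP[/eqP xi' xU'].
    rewrite ltnS leq_eqVlt => /predU1P[jk|]; last exact: agreeV.
    by rewrite (val_inj (jk : val j = val i)) xi xi'.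
have [U' [V' [[U'0 subU] [V'0 subV] closed agreeU agreeV]]] := main n (leqnn n).
case: U' U'0 subU closed agreeU => // u U' _ subU closed agreeU.
case: V' V'0 subV closed agreeV => // v V' _ subV closed agreeV.
exists u, v; split; [exact/subU/mem_head|exact/subV/mem_head|].
move=> u' v' u'U v'V e.
have [u'U' v'V'] := closed u v u' v' (mem_head _ _) (mem_head _ _) u'U v'V e.
split; apply/ffunP => j; [apply: agreeU|apply: agreeV]; rewrite ?mem_head //.
Qed.

Lemma elt_neq0 (g : elt n K) : g != 0 -> enum_fset (finsupp g) != [::].
Proof.
move=> g0; apply/eqP => e; case/eqP: g0; apply/fsfunP => c.
by rewrite ecoef0 fsfun_dflt // -[_ \in _]/(c \in enum_fset (finsupp g)) e.
Qed.

Lemma ecoefM (g h : elt n K) c : (g * h) c =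
  \sum_(a <- finsupp g) \sum_(b <- finsupp h) g a * h b * (a + b == c)%:R.
Proof.
rewrite mulE ecoef_ev; apply: eq_bigr => a _.
rewrite ecoef_ev mulr_sumr; apply: eq_bigr => b _.
by rewrite monoE mulrA.
Qed.

(** The exponent u + v of [unique_sum] arises from a single pair of monomials, so its coefficient in
    the product is [g u * h v], nonzero since u and v lie in the supports. *)
Lemma elt_domain (g h : elt n K) : g * h = 0 -> g = 0 \/ h = 0.
Proof.
move=> gh; have [->|g0] := eqVneq g 0; first by left.
have [->|h0] := eqVneq h 0; first by right.
have [u [v [ug vh uniq]]] := unique_sum (elt_neq0 g0) (elt_neq0 h0).
move/fsfunP/(_ (u + v)) : gh; rewrite ecoef0 ecoefM.
rewrite (big_fsetD1 u) //= (big_fsetD1 v) //= eqxx mulr1.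
rewrite big_seq big1 ?addr0 => [|b]; last first.
  rewrite !inE => /andP[/eqP bv bh]; case: eqP; last by rewrite mulr0.
  by move=> /(uniq _ _ ug bh)[_ /bv].
rewrite big_seq big1 ?addr0 => [|a]; last first.
  rewrite !inE => /andP[/eqP au ag]; rewrite big_seq big1 // => b bh.
  case: eqP; last by rewrite mulr0.
  by move=> /(uniq _ _ ag bh)[/au].
by move: ug vh; rewrite !mem_finsupp => ug vh /eqP; rewrite mulf_eq0 (negPf ug) (negPf vh).
Qed.

Lemma supp_mul (g h : elt n K) c : c \in finsupp (g * h) ->
  exists a b, [/\ a \in finsupp g, b \in finsupp h & c = a + b].
Proof.
rewrite mem_finsupp ecoefM => /eqP nz; apply: contrapT => no; apply: nz.
rewrite big_seq big1 // => a ag; rewrite big_seq big1 // => b bh.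
by case: eqP => [e|]; [case: no; exists a, b|rewrite mulr0].
Qed.

Lemma supp_add (g h : elt n K) c : c \in finsupp (g + h) ->
  c \in finsupp g \/ c \in finsupp h.
Proof.
rewrite !mem_finsupp ecoefD; case: (eqVneq (g c) 0) => [->|_]; last by left.
by rewrite add0r; right.
Qed.

Lemma supp_mono (a c : expo n) : c \in finsupp (mono K a) -> c = a.
Proof. by rewrite mem_finsupp monoE; case: (a =P c) => // _; rewrite eqxx. Qed.

Lemma supp_scale k (g : elt n K) c : c \in finsupp (k *: g) -> c \in finsupp g.
Proof.
by rewrite !mem_finsupp ecoefZ; apply: contra_neq => ->; rewrite mulr0.
Qed.

End Domain.

(** * Membership in monomial ideals through supports *)

Section Ideals.
Variables (n : nat) (K : fieldType) (A : {set 'I_n}).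
Implicit Types (a b c : expo n) (g h : elt n K) (D : expo n -> Prop).

Lemma is_monomP a : reflect (forall j, j \notin A -> 0 <= a j) (is_monom A a).
Proof. exact: (iffP 'forall_implyP). Qed.

Lemma is_monomD a b : is_monom A a -> is_monom A b -> is_monom A (a + b).
Proof.
move=> /is_monomP ma /is_monomP mb; apply/is_monomP => j jA.
by rewrite ffunE addr_ge0 ?ma ?mb.
Qed.

Lemma is_monom0 : is_monom A 0.
Proof. by apply/is_monomP => j _; rewrite ffunE. Qed.

Lemma Sf_mono a : is_monom A a -> in_Sf A (mono K a).
Proof. by move=> ma c /supp_mono ->. Qed.

Lemma Sf_0 : in_Sf A (0 : elt n K).
Proof. by move=> c; rewrite mem_finsupp ecoef0 eqxx. Qed.

Lemma Sf_1 : in_Sf A (1 : elt n K).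
Proof. by rewrite -mono0; apply/Sf_mono/is_monom0. Qed.

Lemma Sf_add g h : in_Sf A g -> in_Sf A h -> in_Sf A (g + h).
Proof. by move=> sg sh c /supp_add[/sg|/sh]. Qed.

Lemma Sf_scale k g : in_Sf A g -> in_Sf A (k *: g).
Proof. by move=> sg c /supp_scale/sg. Qed.

Lemma Sf_mul g h : in_Sf A g -> in_Sf A h -> in_Sf A (g * h).
Proof. by move=> sg sh c /supp_mul[a [b [/sg ma /sh mb ->]]]; exact: is_monomD. Qed.

Lemma Sf_exp g k : in_Sf A g -> in_Sf A (g ^+ k).
Proof.
move=> sg; elim: k => [|k IH]; first by rewrite expr0; exact: Sf_1.
by rewrite exprS; exact: Sf_mul.
Qed.

Lemma Sf_sum (T : Type) (s : seq T) (p : pred T) (F : T -> elt n K) :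
  (forall i, p i -> in_Sf A (F i)) -> in_Sf A (\sum_(i <- s | p i) F i).
Proof. by move=> sF; elim/big_ind: _ => // *; [exact: Sf_0|exact: Sf_add]. Qed.

Lemma Sf_prod (T : Type) (s : seq T) (p : pred T) (F : T -> elt n K) :
  (forall i, p i -> in_Sf A (F i)) -> in_Sf A (\prod_(i <- s | p i) F i).
Proof. by move=> sF; elim/big_ind: _ => // *; [exact: Sf_1|exact: Sf_mul]. Qed.

Section IdealTheory.
Variable P : elt n K -> Prop.
Hypothesis idP : is_ideal A P.

Lemma ideal_Sf g : P g -> in_Sf A g. Proof. by case: idP => + _ _ _; apply. Qed.
Lemma ideal_0 : P 0. Proof. by case: idP. Qed.
Lemma ideal_add g h : P g -> P h -> P (g + h).
Proof. by case: idP => _ _ + _; apply. Qed.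
Lemma ideal_mul g h : in_Sf A g -> P h -> P (g * h).
Proof. by case: idP => _ _ _; apply. Qed.
Lemma ideal_scale k g : P g -> P (k *: g).
Proof.
move=> Pg; rewrite -[g]mul1r scalerAl.
by apply: ideal_mul => //; exact/Sf_scale/Sf_1.
Qed.
Lemma ideal_sub g h : P g -> P h -> P (g - h).
Proof. by move=> Pg Ph; rewrite -scaleN1r; apply: ideal_add => //; exact: ideal_scale. Qed.
Lemma ideal_sum (T : eqType) (s : seq T) (F : T -> elt n K) :
  {in s, forall i, P (F i)} -> P (\sum_(i <- s) F i).
Proof.
move=> PF; rewrite big_seq; elim/big_ind: _ => // *; first exact: ideal_0.
exact: ideal_add.
Qed.

End IdealTheory.

(* The exponents of the monomials in the ideal generated by x^b, b in D. *)
Definition upc D c : Prop :=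
  exists2 b, D b & is_monom A b /\ is_monom A (c - b).

Lemma upc_monom D c : upc D c -> is_monom A c.
Proof. by case=> b _ [mb mcb]; rewrite -(subrK b c); exact: is_monomD. Qed.

Lemma upcD D c b : upc D c -> is_monom A b -> upc D (c + b).
Proof.
case=> a Da [ma mca] mb; exists a => //; split=> //.
by rewrite addrAC; exact: is_monomD.
Qed.

Lemma supp_ideal D : is_ideal A (fun g => {in finsupp g, forall c, upc D c}).
Proof.
split=> [g sg c /sg/upc_monom //|c|g h sg sh c|g h sg sh c].
- by rewrite mem_finsupp elt0E eqxx.
- by rewrite eplus_add => /supp_add[/sg|/sh].
- rewrite etimes_mul => /supp_mul[a [b [/sg ma /sh mb ->]]].
  by rewrite addrC; exact: upcD.
Qed.

(** One direction instantiates the intersection defining [gen_ideal] with [supp_ideal]; in the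
    other, each monomial of g is a multiple of a generator. *)
Lemma gen_idealP D g :
  gen_ideal A D g <-> {in finsupp g, forall c, upc D c}.
Proof.
split=> [gen|sg P idP gens].
  apply: (gen _ (supp_ideal D)) => a Da ma c /supp_mono->; exists a => //; split=> //.
  by rewrite subrr; exact: is_monom0.
rewrite -(ev_id g); apply: ideal_sum => // a /sg[b Db [mb mab]].
apply: ideal_scale => //; rewrite -(subrK b a) monoD.
by apply: ideal_mul => //; [exact: Sf_mono|exact: gens].
Qed.

Lemma gen_ideal_mono D c : gen_ideal A D (mono K c) <-> upc D c.
Proof.
rewrite gen_idealP; split=> [|Dc a /supp_mono->//].
by apply; rewrite mem_finsupp monoE eqxx oner_eq0.
Qed.

Lemma subI_gen D D' : subI (gen_ideal (K := K) A D) (gen_ideal A D') <->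
  forall c, upc D c -> upc D' c.
Proof.
split=> [sub c|sub g]; first by rewrite -!gen_ideal_mono; exact: sub.
by rewrite !gen_idealP => sg c /sg/sub.
Qed.

Lemma eqI_gen D D' : (forall c, upc D c <-> upc D' c) ->
  eqI (gen_ideal (K := K) A D) (gen_ideal A D').
Proof. by move=> e g; rewrite !gen_idealP; split=> sg c /sg/e. Qed.

End Ideals.

(** * Primes generated by variables *)

Section MonomialPrimes.
Variables (n : nat) (K : fieldType) (A : {set 'I_n}).
Implicit Types (a b c : expo n) (g h : elt n K) (Z W : {set 'I_n}).

Definition restr W a : expo n := [ffun j => if j \in W then 0 else a j].

Lemma restrD W a b : restr W (a + b) = restr W a + restr W b.
Proof. by apply/ffunP => j; rewrite !ffunE; case: ifP; rewrite ?addr0. Qed.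

(* The variables in W are set to 0, or to 1 when they are invertible. *)
Definition subst W a : elt n K :=
  if [forall j in W :\: A, a j == 0] then mono K (restr W a) else 0.

Lemma subst0 W : subst W 0 = 1.
Proof.
rewrite /subst ifT; last by apply/forall_inP => j _; rewrite ffunE.
rewrite -mono0; congr mono; apply/ffunP => j; rewrite !ffunE.
by case: ifP.
Qed.

(** Exponents outside A are nonnegative, so a sum vanishes there only if both summands do; this
    makes the test in [subst] multiplicative. *)
Lemma substD W a b : is_monom A a -> is_monom A b ->
  subst W (a + b) = subst W a * subst W b.
Proof.
move=> /is_monomP ma /is_monomP mb; rewrite /subst.
have -> : [forall j in W :\: A, (a + b) j == 0] =
    [forall j in W :\: A, a j == 0] && [forall j in W :\: A, b j == 0].
  apply/forall_inP/andP => [ab0|[/forall_inP a0 /forall_inP b0] j jW]; last first.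
    by rewrite ffunE (eqP (a0 j jW)) (eqP (b0 j jW)).
  split; apply/forall_inP => j jW; have := ab0 j jW; rewrite ffunE;
    have /setDP[_ jA] := jW; rewrite paddr_eq0 ?ma ?mb //; by case/andP.
case: [forall j in _, _]; case: [forall j in _, _];
  by rewrite /= ?mulr0 ?mul0r // restrD monoD.
Qed.

(** The kernel of the substitution on S_f; it is prime because the target is a domain. *)
Definition prime_at W g : Prop := in_Sf A g /\ ev (subst W) g = 0.

Lemma ev_substM W g h : in_Sf A g -> in_Sf A h ->
  ev (subst W) (g * h) = ev (subst W) g * ev (subst W) h.
Proof. by move=> sg sh; apply: ev_mul => a b /sg ma /sh mb; exact: substD. Qed.

Lemma prime_at_prime W : is_prime A (prime_at W).
Proof.
split; first split.
- by move=> g [].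
- by split; [exact: Sf_0|rewrite elt0_zero linear0].
- move=> g h [sg eg] [sh eh]; rewrite eplus_add.
  by split; [exact: Sf_add|rewrite linearD /= eg eh addr0].
- move=> g h sg [sh eh]; rewrite etimes_mul.
  by split; [exact: Sf_mul|rewrite ev_substM // eh mulr0].
- rewrite ezeroE => -[_ /eqP]; rewrite ev_mono subst0.
  by rewrite oner_eq0.
- move=> g h sg sh [_]; rewrite etimes_mul ev_substM // => /elt_domain.
  by case=> e; [left|right].
Qed.

Lemma subst_comp W W' a : W \subset W' ->
  ev (subst W') (subst W a) = subst W' a.
Proof.
move=> sub; rewrite [subst W a]/subst; case: ifPn => [a0|aN].
  rewrite ev_mono /subst; have -> : restr W' (restr W a) = restr W' a.
    apply/ffunP => j; rewrite !ffunE; case: ifPn => // jW'.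
    have /negPf-> // : j \notin W.
    by apply: contra jW'; exact: (subsetP sub).
  congr (if _ then _ else _); apply: eq_forallb => j.
  have [/setDP[_ jA]|//] := boolP (j \in W' :\: A).
  rewrite ffunE; case: ifP => // jW; apply/esym.
  by have /forall_inP := a0; apply; rewrite inE jW jA.
rewrite linear0 /subst ifN //; apply: contra aN => /forall_inP a0.
apply/forall_inP => j /setDP[jW jA]; apply: a0; rewrite inE jA.
exact: (subsetP sub).
Qed.

Lemma prime_at_sub W W' : W \subset W' -> subI (prime_at W) (prime_at W').
Proof.
move=> sub g [sg eg]; split=> //.
rewrite -(eq_ev (fun a _ => subst_comp a sub) : _ = ev (subst W') g).
by rewrite -ev_comp eg linear0.
Qed.

Definition unit_expo (j : 'I_n) : expo n := [ffun i => (i == j)%:R].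

Lemma unit_expo_monom j : is_monom A (unit_expo j).
Proof. by apply/is_monomP => i _; rewrite ffunE ler0n. Qed.

Lemma prime_at_strict W j : j \notin W ->
  strictI (prime_at W) (prime_at (j |: W)).
Proof.
move=> jW; split; first exact/prime_at_sub/subsetUr.
have resj : restr (j |: W) (unit_expo j) = 0.
  apply/ffunP => i; rewrite !ffunE !inE; case: (i =P j) => //=.
  by rewrite if_same.
have evW : subst W (unit_expo j) = mono K (unit_expo j).
  rewrite /subst ifT; last first.
    apply/forall_inP => i /setDP[iW _]; rewrite ffunE.
    by case: (i =P j) => // ij; rewrite -ij iW in jW.
  congr mono; apply/ffunP => i; rewrite !ffunE; case: ifP => // iW.
  by case: (i =P j) => // ij; rewrite -ij iW in jW.
have monoj1 : mono K (unit_expo j) != 1.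
  apply/eqP => /fsfunP/(_ 0)/eqP; rewrite -mono0 !monoE eqxx.
  case: (unit_expo j =P 0) => [|_]; last by rewrite eq_sym oner_eq0.
  by move/ffunP/(_ j)/eqP; rewrite !ffunE eqxx oner_eq0.
have [jA|jA] := boolP (j \in A); last first.
  (* A noninvertible x_j is sent to 0, so x_j itself separates the two kernels. *)
  exists (mono K (unit_expo j)); split.
    split; first exact/Sf_mono/unit_expo_monom.
    rewrite ev_mono /subst ifN //; apply/negP => /forall_inP/(_ j).
    by rewrite !inE eqxx jA ffunE eqxx oner_eq0 => /(_ isT).
  move=> [_]; rewrite ev_mono evW => /fsfunP/(_ (unit_expo j))/eqP.
  by rewrite monoE eqxx ecoef0 oner_eq0.
(* An invertible x_j is sent to 1, so x_j - 1 separates them. *)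
exists (mono K (unit_expo j) - 1); split.
  split.
    apply: Sf_add; first exact/Sf_mono/unit_expo_monom.
    by rewrite -scaleN1r; exact/Sf_scale/Sf_1.
  rewrite linearB /= -mono0 !ev_mono subst0 /subst ifT.
    by rewrite resj mono0 subrr.
  apply/forall_inP => i /setDP[_ iA]; rewrite ffunE.
  by case: (i =P j) => // ij; rewrite ij jA in iA.
move=> [_] /eqP; rewrite linearB /= -mono0 !ev_mono subst0 evW subr_eq0.
exact/negP.
Qed.

(** For Z disjoint from A, the monomials of S_f divisible by some x_j with j in Z; they generate the
    prime (x_j : j in Z). *)
Definition pos_on Z c : Prop := exists2 j, j \in Z & 0 < c j.

Lemma upc_pos_on Z c : Z \subset ~: A ->
  upc A (pos_on Z) c <-> is_monom A c /\ pos_on Z c.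
Proof.
move=> ZA; split=> [up|[mc Zc]]; last first.
  by exists c => //; rewrite subrr; split=> //; exact: is_monom0.
split; first exact: upc_monom up.
case: up => b [j jZ bj] [_ /is_monomP mcb]; exists j => //.
have := mcb j; rewrite -in_setC (subsetP ZA) // !ffunE => /(_ isT).
by rewrite subr_ge0; exact: lt_le_trans.
Qed.

(** For Z disjoint from A the substitution either kills a monomial or fixes it, so an element of the
    kernel has no fixed monomial in its support. *)
Lemma prime_at_gen Z : Z \subset ~: A ->
  eqI (prime_at Z) (gen_ideal A (pos_on Z)).
Proof.
move=> ZA g.
have sub0 a : is_monom A a ->
    subst Z a = if [forall j in Z, a j == 0] then mono K a else 0.
  move=> ma; rewrite /subst (setDidPl _) ?disjoints_subset //.
  case: ifP => // /forall_inP a0; congr mono; apply/ffunP => j.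
  by rewrite ffunE; case: ifP => // /a0/eqP.
have posN a : is_monom A a -> [forall j in Z, a j == 0] <-> ~ pos_on Z a.
  move=> /is_monomP ma; split=> [/forall_inP a0 [j /a0/eqP->]|np].
    by rewrite ltxx.
  apply/forall_inP => j jZ; apply: contrapT => aj; apply: np; exists j => //.
  by rewrite lt_def; apply/andP; split; [exact/negP|apply: ma; rewrite -in_setC (subsetP ZA)].
rewrite gen_idealP; split=> [[sg eg] c cg|sg].
  apply/(upc_pos_on _ ZA); split; first exact: sg.
  apply: contrapT => /(posN _ (sg c cg)) c0.
  have : ev (subst Z) g c = 0 by rewrite eg ecoef0.
  rewrite ecoef_ev (big_fsetD1 c) //= sub0 ?(sg c cg) // c0 monoE eqxx mulr1.
  rewrite big_seq big1 ?addr0 => [/eqP|a].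
    by rewrite mem_finsupp in cg; rewrite (negPf cg).
  rewrite !inE => /andP[/eqP ac ag]; rewrite sub0 ?(sg a ag) //.
  case: ifP; last by rewrite ecoef0 mulr0.
  by rewrite monoE; case: eqP => // _; rewrite mulr0.
have mg a : a \in finsupp g -> is_monom A a /\ pos_on Z a.
  by move=> /sg /(upc_pos_on _ ZA).
split=> [a /mg[]//|]; rewrite /ev big_seq big1 // => a /mg[ma pa].
rewrite sub0 //; case: ifP => [/(posN _ ma)//|_]; exact: scaler0.
Qed.

Lemma pos_on_prime Z : Z \subset ~: A ->
  is_prime A (gen_ideal (K := K) A (pos_on Z)).
Proof.
move=> /prime_at_gen/(_ _)/propext e.
have <- : prime_at Z = gen_ideal A (pos_on Z) by apply/funext.
exact: prime_at_prime.
Qed.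

Lemma prime_chain_pos_on Z : Z \subset ~: A ->
  exists Q, prime_chain A (gen_ideal (K := K) A (pos_on Z)) Q (n - #|Z|).
Proof.
move=> ZA; pose s := enum (~: Z).
have size_s : size s = (n - #|Z|)%N.
  by rewrite -cardE cardsCs setCK card_ord.
exists (fun i => prime_at (Z :|: [set j in take i s])); split.
- move=> g /(prime_at_gen ZA); rewrite take0.
  by apply: prime_at_sub; exact: subsetUl.
- by move=> i _; exact: prime_at_prime.
- move=> i; rewrite -size_s => ilt.
  have x0 : 'I_n by case: (s) ilt => [|x] //.
  have -> : Z :|: [set j in take i.+1 s] =
      nth x0 s i |: (Z :|: [set j in take i s]).
    apply/setP => j; rewrite (take_nth x0) // !inE mem_rcons inE.
    by rewrite orbCA.
  apply: prime_at_strict; rewrite !inE negb_or.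
  have : nth x0 s i \in s by exact: mem_nth.
  rewrite mem_enum inE => -> /=.
  have : uniq s by exact: enum_uniq.
  rewrite -{1}(cat_take_drop i s) cat_uniq => /and3P[_ /hasPn disj _].
  by apply: disj; rewrite (drop_nth x0) // mem_head.
Qed.

End MonomialPrimes.

(** * Krull dimension *)

Section UpperBound.
Variables (n : nat) (K : fieldType) (A : {set 'I_n}).
Implicit Types (a b c : expo n) (g h : elt n K) (Z W : {set 'I_n}).

Lemma prime_ideal (P : elt n K -> Prop) : is_prime A P -> is_ideal A P.
Proof. by case. Qed.

Lemma prime_neq1 (P : elt n K -> Prop) : is_prime A P -> ~ P 1.
Proof. by case=> _ + _; rewrite mono_ezero. Qed.

Lemma prime_mul (P : elt n K -> Prop) g h : is_prime A P ->
  in_Sf A g -> in_Sf A h -> P (g * h) -> P g \/ P h.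
Proof. by case=> _ _; apply. Qed.

Lemma prime_exp (P : elt n K -> Prop) g k : is_prime A P ->
  in_Sf A g -> P (g ^+ k) -> P g.
Proof.
move=> prP sg; elim: k => [|k IH]; first by rewrite expr0 => /(prime_neq1 prP).
by rewrite exprS => /(prime_mul prP sg (Sf_exp sg))[].
Qed.

(* Keep only the lexicographically smallest monomial of a relation: having
   divided by the power of x_k, the other terms are multiples of x_k, hence
   vanish modulo Q_(k+1). *)
Lemma chain_independent l (Q : nat -> elt n K -> Prop) (x : 'I_l -> elt n K)
    D (c : {ffun 'I_l -> 'I_D} -> K) :
    (forall i, (i <= l)%N -> is_prime A (Q i)) ->
    (forall i, (i < l)%N -> subI (Q i) (Q i.+1)) ->
    (forall i : 'I_l, Q i.+1 (x i)) -> (forall i : 'I_l, ~ Q i (x i)) ->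
    (exists f, c f != 0) ->
  ~ Q 0%N (\sum_f c f *: \prod_i x i ^+ f i).
Proof.
move=> prQ subQ xQ xNQ [f0 cf0] rel.
have sx i : in_Sf A (x i).
  by apply: (ideal_Sf (prime_ideal (prQ i.+1 (ltn_ord i)))); exact: xQ.
pose R k (f : {ffun 'I_l -> 'I_D}) := \prod_(i < l | (k <= i)%N) x i ^+ f i.
have sR k f : in_Sf A (R k f) by apply: Sf_prod => i _; exact: Sf_exp.
(* Invariant: the surviving exponents agree below k, and the relation, with the powers of the first
   k elements divided out, holds modulo [Q k]. *)
have main k : (k <= l)%N -> exists S : {set {ffun 'I_l -> 'I_D}},
   [/\ S != set0, {in S, forall f, c f != 0},
       {in S &, forall (f f' : {ffun 'I_l -> 'I_D}) (i : 'I_l), (i < k)%N -> f i = f' i} &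
       Q k (\sum_(f in S) c f *: R k f)].
  elim: k => [_|k IH kl].
    exists [set f | c f != 0]; split=> //.
    - by apply/set0Pn; exists f0; rewrite inE.
    - by move=> f; rewrite inE.
    move: rel; rewrite (bigID (fun f => c f == 0)) /= big1 ?add0r.
      by under [in X in _ -> X]eq_bigl do rewrite inE.
    by move=> f /eqP->; rewrite scale0r.
  have [S [/set0Pn[f1 f1S] cS agree relS]] := IH (ltnW kl).
  pose i := Ordinal kl.
  case: (@arg_minnP _ f1 (mem S) (fun f => val (f i)) f1S) => f2 f2S fmin.
  pose S' := [set f : {ffun 'I_l -> 'I_D} | f i == f2 i].
  exists (S :&: S'); split.
  - by apply/set0Pn; exists f2; rewrite !inE eqxx andbT.
  - by move=> f /setIP[/cS].
  - move=> f f'; rewrite !inE => /andP[fS /eqP fi] /andP[fS' /eqP fi'] j.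
    rewrite ltnS leq_eqVlt => /predU1P[jk|]; last exact: agree.
    by rewrite (val_inj (jk : val j = val i)) fi fi'.
  pose T := \sum_(f in S) c f *: (x i ^+ (f i - f2 i) * R k.+1 f).
  have eT : \sum_(f in S) c f *: R k f = x i ^+ f2 i * T.
    rewrite mulr_sumr; apply: eq_bigr => f fS.
    rewrite -scalerAr mulrA -exprD subnKC ?fmin //; congr (_ *: _).
    rewrite /R (bigD1 i) //=; congr (_ * _); apply: eq_bigl => j.
    by rewrite ltn_neqAle andbC eq_sym.
  have sT : in_Sf A T.
    by apply: Sf_sum => f _; apply/Sf_scale/Sf_mul => //; exact: Sf_exp.
  have prk := prQ _ (ltnW kl); have idk1 := prime_ideal (prQ _ kl).
  rewrite {}eT in relS.
  have [/(prime_exp prk (sx i))/(xNQ i)//|QT] :=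
    prime_mul prk (Sf_exp (sx i)) sT relS.
  have := subQ _ kl _ QT; rewrite /T (big_setID S') /=.
  set t1 := \sum_(f in _) _; set t2 := \sum_(f in _) _ => Qt.
  have -> : \sum_(f in S :&: S') c f *: R k.+1 f = t1 + t2 - t2.
    rewrite addrK; apply: eq_bigr => f /setIP[_]; rewrite inE => /eqP ->.
    by rewrite subnn expr0 mul1r.
  apply: (ideal_sub idk1) => //; rewrite /t2 -big_enum.
  apply: (ideal_sum idk1) => f; rewrite mem_enum => /setDP[fS]; rewrite inE => fi.
  apply: (ideal_scale idk1); rewrite mulrC; apply: (ideal_mul idk1) => //.
  have : (f2 i < f i)%N by rewrite ltn_neqAle eq_sym fi fmin.
  rewrite -subn_gt0; case: (_ - _)%N => // e _; rewrite exprSr.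
  by apply: (ideal_mul idk1); [exact: Sf_exp|exact: (xQ i)].
(* A single exponent is left and [R l] is an empty product, so the relation is a nonzero constant in
   [Q l]. *)
have [S [/set0Pn[f fS] cS agree]] := main l (leqnn l).
have -> : S = [set f].
  apply/setP => f'; rewrite inE; apply/idP/eqP => [f'S|->//].
  by apply/ffunP => i; apply: agree.
have idl := prime_ideal (prQ l (leqnn l)).
rewrite big_set1 /R big_pred0 => [Q1|i]; last by rewrite leqNgt ltn_ord.
apply: (prime_neq1 (prQ l (leqnn l))).
rewrite -[X in Q l X](scalerK (cS f fS)); exact: (ideal_scale idl).
Qed.

(** * Counting monomials in a box *)

Definition bounded (e : nat) g : Prop :=
  {in finsupp g, forall a j, (`|a j| <= e)%N}.

Lemma bounded_sub e e' g : (e <= e')%N -> bounded e g -> bounded e' g.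
Proof. by move=> le bg a /bg ba j; exact: leq_trans (ba j) le. Qed.

Lemma bounded_exists g : exists e, bounded e g.
Proof.
exists (\sum_(a <- finsupp g) \sum_(j < n) `|a j|)%N => a ag j.
by rewrite (big_fsetD1 a) //= (bigD1 j) //= -addnA leq_addr.
Qed.

Lemma bounded_mul e e' g h :
  bounded e g -> bounded e' h -> bounded (e + e') (g * h).
Proof.
move=> bg bh c /supp_mul[a [b [/bg ba /bh bb ->]]] j.
move: (ba j) (bb j); rewrite ffunE; move: (a j) (b j) => p q; lia.
Qed.

Lemma bounded1 e : bounded e 1.
Proof. by move=> a; rewrite -mono0 => /supp_mono-> j; rewrite ffunE. Qed.

Lemma bounded_exp e g k : bounded e g -> bounded (k * e) (g ^+ k).
Proof.
move=> bg; elim: k => [|k IH]; first by rewrite expr0; exact: bounded1.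
by rewrite exprS mulSn; exact: bounded_mul.
Qed.

Lemma bounded_prod e l (F : 'I_l -> elt n K) :
  (forall i, bounded e (F i)) -> bounded (l * e) (\prod_i F i).
Proof.
move=> bF; elim: l F bF => [|l IH] F bF.
  by rewrite big_ord0; exact: bounded1.
by rewrite big_ord_recl mulSn; apply: bounded_mul => //; exact: IH.
Qed.

Lemma left_kernel_neq0 (r s : nat) (M : 'M[K]_(r, s)) : (s < r)%N ->
  exists2 u : 'rV_r, u != 0 & u *m M = 0.
Proof.
move=> sr; have /rowV0Pn[u /sub_kermxP uM u0] : kermx M != 0.
  by rewrite -mxrank_eq0 mxrank_ker -lt0n subn_gt0 (leq_ltn_trans (rank_leq_col M)).
by exists u.
Qed.

(** The D^l products with exponents below D have their monomials in a box of side O(D). Modulo (x_j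
    : j in Z) only m = n - |Z| coordinates count, hence O(D^m) coefficients; as l > m, a large D
    forces a linear dependence. *)
Lemma algebraic_relation Z l (x : 'I_l -> elt n K) : Z \subset ~: A ->
    (n - #|Z| < l)%N -> (forall i, in_Sf A (x i)) ->
  exists D (c : {ffun 'I_l -> 'I_D} -> K), (exists f, c f != 0) /\
    gen_ideal A (pos_on Z) (\sum_f c f *: \prod_i x i ^+ f i).
Proof.
move=> ZA dim_l sx; pose m := (n - #|Z|)%N.
have [e be] : exists e, forall i, bounded e (x i).
  have /choice[e be] := fun i => bounded_exists (x i).
  exists (\sum_i e i)%N => i; apply: bounded_sub (be i).
  by rewrite (bigD1 i) //= leq_addr.
(* [B] bounds the exponents of all products. The choice of [w] gives 2B + 1 <= w D, and that of [D]
   gives w^m D^m < D^(m+1) <= D^l, so [M] has fewer columns than rows. *)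
pose w := (2 * (l * e)).+1; pose D := (w ^ m).+1; pose B := (l * (D * e))%N.
pose p (f : {ffun 'I_l -> 'I_D}) := \prod_i x i ^+ f i.
have bp f : bounded B (p f).
  apply: bounded_prod => i; apply: bounded_sub (bounded_exp (k := f i) (be i)).
  by rewrite leq_mul2r (ltnW (ltn_ord _)) orbT.
have sp f : in_Sf A (p f) by apply: Sf_prod => i _; exact: Sf_exp.
pose J := {j : 'I_n | j \notin Z}.
pose C := {ffun J -> 'I_(2 * B).+1}.
(* Box points with exponent 0 along Z: the monomials that can survive modulo (x_j : j in Z). *)
pose pt (v : C) : expo n :=
  [ffun j => if insub j is Some k then (v k)%:Z - B%:Z else 0].
pose M := \matrix_(i < #|{ffun 'I_l -> 'I_D}|, j < #|C|)
  p (enum_val i) (pt (enum_val j)).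
have cardC : #|C| = ((2 * B).+1 ^ m)%N.
  rewrite card_ffun card_ord card_sig; congr (_ ^ _)%N.
  transitivity #|~: Z|; first by apply: eq_card => j; rewrite !inE.
  by rewrite cardsCs setCK card_ord.
have lt_card : (#|C| < #|{ffun 'I_l -> 'I_D}|)%N.
  rewrite cardC card_ffun !card_ord.
  apply: (@leq_ltn_trans ((w * D) ^ m)).
    have le_wD : ((2 * B).+1 <= w * D)%N.
      rewrite /w /B (mulnC D e) !mulnA [(_.+1 * D)%N]mulSn.
      exact: (leq_add (ltn0Sn _ : 0 < D)%N (leqnn _)).
    case: (posnP m) => [->|m0]; first by rewrite !expn0.
    by rewrite leq_exp2r.
  rewrite expnMn; apply: (@leq_trans (D ^ m.+1)).
    by rewrite expnS ltn_mul2r expn_gt0; exact: ltnSn.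
  exact: leq_pexp2l.
have [u u0 uM] := left_kernel_neq0 M lt_card.
exists D, (fun f => u 0 (enum_rank f)); split.
  have [i ui] : exists i, u 0 i != 0.
    apply: contrapT => no; case/eqP: u0; apply/rowP => i; rewrite mxE.
    by apply: contrapT => ui; apply: no; exists i; apply/eqP.
  by exists (enum_val i); rewrite enum_valK.
set g := \sum_f _.
have sg : in_Sf A g by apply: Sf_sum => f _; apply: Sf_scale; exact: sp.
have gE a : g a = \sum_f u 0 (enum_rank f) * p f a.
  rewrite /g; elim/big_rec2: _ => [|f y z _ <-]; first exact: ecoef0.
  by rewrite ecoefD ecoefZ.
rewrite gen_idealP => a ag; apply/(upc_pos_on _ ZA); split; first exact: sg.
have /eqP ga : g a != 0 by rewrite -(mem_finsupp g a).
(* A monomial of the combination outside the ideal would be one of the points [pt v], where the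
   kernel vector makes the coefficient vanish. *)
apply: contrapT => npos.
have aZ j : j \in Z -> a j = 0.
  move=> jZ; apply/eqP; rewrite eq_le; apply/andP; split.
    by rewrite leNgt; apply/negP => aj; apply: npos; exists j.
  by have /is_monomP := sg a ag; apply; rewrite -in_setC (subsetP ZA).
have aB j : (`|a j| <= B)%N.
  apply: contrapT => aj; apply: ga; rewrite gE.
  rewrite big1 // => f _; have [af|af] := boolP (a \in finsupp (p f)).
    by case: aj; exact: bp af j.
  by rewrite (fsfun_dflt af) mulr0.
apply: ga; pose v : C := [ffun k => inord `|((a : expo n) (val k) + B%:Z)%R|%N].
have -> : a = pt v.
  apply/ffunP => j; rewrite ffunE; case: insubP => [k _ kj|].
    have := aB j; rewrite ffunE => qB; rewrite inordK kj; move: (a j) qB => q; lia.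
  by rewrite negbK => /aZ.
move/rowP/(_ (enum_rank v)) : uM; rewrite !mxE => uM.
rewrite gE -[RHS]uM (reindex (enum_val (A := {ffun 'I_l -> 'I_D}))) /=.
  by apply: eq_bigr => i _; rewrite mxE !enum_rankK enum_valK.
by apply: onW_bij; exists enum_rank; [exact: enum_valK|exact: enum_rankK].
Qed.

Lemma krull_dim_pos_on Z : Z \subset ~: A ->
  krull_dim_quot A (gen_ideal (K := K) A (pos_on Z)) (n - #|Z|).
Proof.
move=> ZA; split; first exact: prime_chain_pos_on.
case=> Q [subP prQ strQ]; pose l := (n - #|Z|).+1.
have /choice[x xQ] (i : 'I_l) : exists g, Q i.+1 g /\ ~ Q i g.
  by have [_] := strQ i (ltn_ord i).
have sx i : in_Sf A (x i).
  by apply: (ideal_Sf (prime_ideal (prQ i.+1 (ltn_ord i)))); case: (xQ i).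
have [D [c [c0 rel]]] := algebraic_relation ZA (ltnSn _) sx.
apply: (chain_independent prQ _ _ _ c0 (subP _ rel)) => i.
- by move=> /strQ[].
- by case: (xQ i).
- by case: (xQ i).
Qed.

End UpperBound.

(** * Prime filtrations *)

(** Jump repeatedly to a place where g is minimal on the remaining tail; the minima of shrinking
    tails are nondecreasing. *)
Lemma monotone_subsequence (g : nat -> nat) :
  exists phi : nat -> nat, forall i j, (i < j)%N ->
    (phi i < phi j)%N /\ (g (phi i) <= g (phi j))%N.
Proof.
have /choice[s sP] N : exists m, (N <= m)%N /\
    forall j, (N <= j)%N -> (g m <= g j)%N.
  have ex : exists v, `[< exists2 m, (N <= m)%N & g m = v >].
    by exists (g N); apply/asboolP; exists N.
  case: (ex_minnP ex) => v /asboolP[m Nm <-] vmin.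
  exists m; split=> // j Nj; apply: vmin; apply/asboolP; by exists j.
pose phi := fix phi i := if i is i'.+1 then s (phi i').+1 else s 0%N.
have inc i : (phi i < phi i.+1)%N by case: (sP (phi i).+1).
have low i j : (i <= j)%N -> (g (phi i) <= g (phi j))%N.
  (* [phi i] minimises g on a tail starting at some N, and [phi j] lies in that tail. *)
  move=> ij; have [N [phi_i Nj]] : exists N, phi i = s N /\ (N <= phi j)%N.
    have mono_phi : (phi i <= phi j)%N.
      by apply: (homo_leq (leqnn) leq_trans) ij => k; exact: ltnW.
    case: i {ij} mono_phi => [|i] le; first by exists 0%N.
    exists (phi i).+1; split=> //; exact: leq_trans (inc i) le.
  by rewrite phi_i; have [_] := sP N; apply.
exists phi => i j ij; split; last exact/low/ltnW.
by apply: (homo_ltn ltn_trans) ij.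
Qed.

Section Filtration.
Variables (n : nat) (A : {set 'I_n}).
Implicit Types (a b c : expo n) (U V I J : expo n -> Prop).

(** Subsequences are extracted one coordinate at a time, so that in the end all coordinates outside
    A are nondecreasing; the first two terms then compare. *)
Lemma dickson (f : nat -> expo n) : (forall i, is_monom A (f i)) ->
  exists i j, (i < j)%N /\ is_monom A (f j - f i).
Proof.
move=> mf.
suff main k : (k <= n)%N -> exists phi : nat -> nat, forall i j, (i < j)%N ->
   (phi i < phi j)%N /\ forall t : 'I_n, (t < k)%N -> t \notin A ->
     f (phi i) t <= f (phi j) t.
  have [phi /(_ 0%N 1%N isT)[lt le]] := main n (leqnn n).
  exists (phi 0%N), (phi 1%N); split=> //; apply/is_monomP => t tA.
  by rewrite !ffunE subr_ge0 le.
elim: k => [_|k IH kn]; first by exists id => i j.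
have [phi phiP] := IH (ltnW kn); pose t0 := Ordinal kn.
have [psi psiP] := monotone_subsequence (fun i => `|f (phi i) t0|%N).
exists (phi \o psi) => i j /psiP[lt le]; have [lt' le'] := phiP _ _ lt.
split=> // t; rewrite ltnS leq_eqVlt => /predU1P[tk|]; last exact: le'.
rewrite (val_inj (tk : val t = val t0)) => tA.
have /is_monomP/(_ _ tA) := mf (phi (psi i)).
have /is_monomP/(_ _ tA) := mf (phi (psi j)).
move: le => /=; move: (f _ t0) (f _ t0) => p q; lia.
Qed.

(** The exponent set of a monomial ideal of S_f. *)
Definition upset U : Prop :=
  (forall c, U c -> is_monom A c) /\
  forall c b, U c -> is_monom A b -> U (c + b).

Lemma upc_upset U c : upset U -> upc A U c <-> U c.
Proof.
case=> mU upU; split=> [[b Ub [_ mcb]]|Uc].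
  by rewrite -(subrK b c) addrC; exact: upU.
by exists c => //; rewrite subrr; split; [exact: mU|exact: is_monom0].
Qed.

Lemma upset_upc U : upset (upc A U).
Proof. by split=> [c /upc_monom|c b]; last exact: upcD. Qed.

Definition lt_up U V : Prop :=
  (forall c, U c -> V c) /\ exists2 c, V c & ~ U c.

(** Noetherian induction: a failure would yield an infinite strictly increasing chain of upsets.
    Among exponents new at each stage, [dickson] finds one dividing a later one, which was then not
    new. *)
Lemma upset_ind (P : (expo n -> Prop) -> Prop) :
    (forall U, upset U -> (forall V, upset V -> lt_up U V -> P V) -> P U) ->
  forall U, upset U -> P U.
Proof.
move=> ind U0 upU0; apply: contrapT => NP0.
pose T := {U | upset U /\ ~ P U}.
have /choice[next nextP] (U : T) : exists V : T, lt_up (sval U) (sval V).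
  case: U => U [upU NPU] /=; apply: contrapT => no; apply: NPU.
  apply: ind => // V upV UV; apply: contrapT => NPV.
  by apply: no; exists (exist _ V (conj upV NPV)).
pose W i : T := iter i next (exist _ U0 (conj upU0 NP0)).
have sub i j : (i <= j)%N -> forall c, sval (W i) c -> sval (W j) c.
  move=> /subnK <-; elim: (j - i)%N => // k IH c /IH.
  by have [+ _] := nextP (W (k + i)%N); apply.
have /choice[x xP] i : exists c, sval (W i.+1) c /\ ~ sval (W i) c.
  by have [_ [c Wc NWc]] := nextP (W i); exists c.
have upW i : upset (sval (W i)) by case: (svalP (W i)).
have [i|i [j [ij mij]]] := dickson (f := x).
  by have [m _] := upW i.+1; apply: m; case: (xP i).
have [_ Nj] := xP j; apply: Nj; apply: (sub _ _ ij).
rewrite -(subrK (x i) (x j)) addrC; have [_ up] := upW i.+1.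
by apply: up => //; case: (xP i).
Qed.

(* A pair c with (J : x^c) maximal among the colon ideals of I/J, phrased on
   exponents: multiplying x^c by a monomial not killing it does not enlarge
   its annihilator. *)
Lemma maximal_colon I J : upset I -> upset J -> (exists2 c, I c & ~ J c) ->
  exists c, [/\ I c, ~ J c & forall b d, is_monom A b -> is_monom A d ->
    ~ J (c + b) -> J (c + b + d) -> J (c + d)].
Proof.
move=> [_ upI] [_ upJ] [c0 Ic0 NJc0].
pose col c b := is_monom A b /\ J (c + b).
have up_col c : upset (col c).
  split=> [b [] //|b d [mb Jcb] md].
  by split; [exact: is_monomD|rewrite addrA; exact: upJ].
(* The induction runs on the colon set, with c allowed to change along it. *)
suff ind U : upset U -> forall c, U = col c -> I c -> ~ J c ->
   exists c, [/\ I c, ~ J c & forall b d, is_monom A b -> is_monom A d ->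
     ~ J (c + b) -> J (c + b + d) -> J (c + d)].
  exact: (ind _ (up_col c0)).
move: U; apply: upset_ind => U _ IH c eU Ic NJc; subst U.
have [good|/existsNP[b /existsNP[d /not_implyP[mb /not_implyP[md
    /not_implyP[Nb /not_implyP[Jbd Nd]]]]]]] := pselect (forall b d,
  is_monom A b -> is_monom A d -> ~ J (c + b) -> J (c + b + d) -> J (c + d)).
  by exists c.
(* A failure of maximality at b, d makes the colon at c + b strictly larger, with d as a new
   element; restart from c + b. *)
apply: (IH (col (c + b))) => //; last exact: upI.
split=> [e [me Je]|].
  by split=> //; rewrite addrAC; exact: upJ.
by exists d => // -[_ /Nd].
Qed.

(** A maximal colon ideal is prime, and a monomial prime is generated by variables. Variables in A
    are units, so the A-part of the exponent can be divided out. *)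
Lemma colon_prime I J : upset I -> upset J -> (exists2 c, I c & ~ J c) ->
  exists (a : expo n) (Z : {set 'I_n}),
    [/\ Z \subset ~: A, I a, forall j, 0 <= a j, forall j, j \in A -> a j = 0 &
        forall d, is_monom A d -> J (a + d) <-> pos_on Z d].
Proof.
move=> uI uJ IJ; have [c [Ic NJc good]] := maximal_colon uI uJ IJ.
have [mI upI] := uI; have [mJ upJ] := uJ.
pose Z := [set j | `[< J (c + unit_expo j) >]].
have JE d e : is_monom A e -> is_monom A (- e) -> J (d + e) <-> J d.
  move=> me mNe; split=> Jd; last exact: upJ.
  by rewrite -(addrK e d); exact: upJ.
have ZA : Z \subset ~: A.
  apply/subsetP => j; rewrite !inE => /asboolP Jj; apply/negP => jA.
  apply: NJc; apply/(JE _ (unit_expo j)) => //; first exact: unit_expo_monom.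
  apply/is_monomP => i iA; rewrite !ffunE; case: eqP => // ij.
  by rewrite ij jA in iA.
have colE d : is_monom A d -> J (c + d) <-> pos_on Z d.
  move=> md; split=> [|[j]]; last first.
    rewrite inE => /asboolP Jj dj.
    rewrite -(subrK (unit_expo j) d) [d - _ + _]addrC addrA.
    apply: upJ => //; apply/is_monomP => i iA; rewrite !ffunE.
    have /is_monomP/(_ _ iA) := md; case: eqP => [->|_]; last by rewrite subr0.
    by move: dj; move: (d j) => p /=; lia.
  move=> Jd; apply: contrapT => Npos.
  have {Npos}dZ j : j \in Z -> d j <= 0.
    by move=> jZ; rewrite leNgt; apply/negP => dj; apply: Npos; exists j.
  (* Variables or their inverses are stripped from d one at a time without leaving the colon;
     reaching d = 0 would put x^c in J. *)
  have [m] := ubnP (deg1 d); elim: m d md Jd dZ => // m IH d md Jd dZ.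
  rewrite ltnS => dm.
  have [d0|/existsNP[j /eqP dj]] := pselect (forall j, d j = 0).
    apply: NJc; rewrite -[c]addr0; congr (J (_ + _)): Jd.
    by apply/ffunP => j; rewrite d0 ffunE.
  (* One step towards d at coordinate j: x_j, or its inverse if the exponent is negative, which
     happens only for j in A. *)
  pose b : expo n := [ffun i => if i == j then sgz (d j) else 0].
  have mb : is_monom A b.
    apply/is_monomP => i iA; rewrite ffunE; case: eqP => // ij.
    by rewrite sgz_ge0 -ij; have /is_monomP := md; apply.
  have mdb : is_monom A (d - b).
    apply/is_monomP => i iA; rewrite !ffunE; have /is_monomP/(_ _ iA) := md.
    by case: eqP => [->|_]; [move: (d j) => p; lia|rewrite subr0].
  (* x^b is outside the colon: it is a unit if j is in A, and otherwise j would be in Z, where d is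
     nonpositive. Maximality then keeps d - b in the colon. *)
  have NJb : ~ J (c + b).
    have [jA|jA] := boolP (j \in A).
      apply/(JE _ b) => //; apply/is_monomP => i iA; rewrite !ffunE.
      by case: eqP => // ij; rewrite ij jA in iA.
    have dj0 : 0 < d j by rewrite lt_def dj; have /is_monomP := md; apply.
    have -> : b = unit_expo j.
      by apply/ffunP => i; rewrite !ffunE gtr0_sgz //; case: eqP.
    move=> Jj; suff : d j <= 0 by rewrite leNgt dj0.
    by apply: dZ; rewrite inE; apply/asboolP.
  apply: (IH (d - b)) => //.
  - by apply: good mb mdb NJb _; rewrite -addrA [b + _]addrC subrK.
  - move=> i iZ; have := dZ i iZ; rewrite !ffunE.
    by case: eqP => [->|_]; [move: (d j) => p; lia|rewrite subr0].
  - apply: leq_trans dm; rewrite /deg1 (bigD1 j) //= [X in (_ < X)%N](bigD1 j) //=.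
    rewrite !ffunE eqxx -addSn leq_add //; last first.
      apply: leq_sum => i ij; rewrite !ffunE (negPf ij) subr0 //.
    by move: dj; move: (d j) => p; lia.
(* The unit part of x^c; removing it makes the shift vanish on A without changing the colon. *)
pose e : expo n := [ffun j => if j \in A then c j else 0].
have me : is_monom A e by apply/is_monomP => j /negPf jA; rewrite ffunE jA.
have mNe : is_monom A (- e).
  by apply/is_monomP => j /negPf jA; rewrite !ffunE jA oppr0.
exists (c - e), Z; split=> //.
- exact: upI.
- move=> j; rewrite !ffunE; case: ifPn => jA; first by rewrite subrr.
  by rewrite subr0; have /is_monomP := mI _ Ic; apply.
- by move=> j jA; rewrite !ffunE jA subrr.
- move=> d md; rewrite -colE // addrAC; apply: JE => //; by rewrite opprK.
Qed.

Lemma prime_filtration I : upset I -> forall J, upset J ->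
    (forall c, J c -> I c) ->
  exists (r : nat) (L : nat -> expo n -> Prop) (Z : nat -> {set 'I_n})
      (a : nat -> expo n),
    [/\ L 0%N = J, L r = I, forall i, (i <= r)%N -> upset (L i),
        forall i, (i < r)%N -> forall c, L i c -> L i.+1 c &
        forall i, (i < r)%N ->
        [/\ Z i \subset ~: A, forall j, 0 <= a i j,
            forall j, j \in A -> a i j = 0 &
            forall c, L i.+1 c /\ ~ L i c <->
              is_monom A (c - a i) /\ ~ pos_on (Z i) (c - a i)]].
Proof.
move=> uI; apply: upset_ind => J uJ IH JI.
have [IJ|/existsNP[c /not_implyP[Ic NJc]]] := pselect (forall c, I c -> J c).
  have -> : J = I by apply/funext => c; apply/propext; split; [exact: JI|exact: IJ].
  by exists 0%N, (fun=> I), (fun=> set0), (fun=> 0); split.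
have [a [Z [ZA Ia a0 aA JE]]] :
    exists (a : expo n) (Z : {set 'I_n}),
    [/\ Z \subset ~: A, I a, forall j, 0 <= a j, forall j, j \in A -> a j = 0 &
        forall d, is_monom A d -> J (a + d) <-> pos_on Z d].
  by apply: colon_prime => //; exists c.
have ma : is_monom A a by apply/is_monomP => j _.
have NJa : ~ J a.
  by rewrite -[a]addr0 JE ?is_monom0 // => -[j _]; rewrite ffunE ltxx.
have [mI upI] := uI; have [mJ upJ] := uJ.
(* Adjoin x^a to J; by the choice of a the new monomials are the a + d with d outside the prime of
   Z. *)
pose J' c := J c \/ is_monom A (c - a).
have uJ' : upset J'.
  split=> [d [/mJ//|mda]|d b [Jd|mda] mb].
  - by rewrite -(subrK a d); exact: is_monomD.
  - by left; exact: upJ.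
  - by right; rewrite addrAC; exact: is_monomD.
have JJ' : lt_up J J'.
  split=> [d|]; first by left.
  by exists a => //; right; rewrite subrr; exact: is_monom0.
have J'I d : J' d -> I d.
  by case=> [/JI//|mda]; rewrite -(subrK a d) addrC; exact: upI.
have [r [L [Zs [as' [L0 Lr uL subL stepL]]]]] := IH J' uJ' JJ' J'I.
exists r.+1, (fun i => if i is i'.+1 then L i' else J),
  (fun i => if i is i'.+1 then Zs i' else Z),
  (fun i => if i is i'.+1 then as' i' else a); split=> //.
- by case.
- by case=> [_|i /subL//]; rewrite L0 => d; left.
- case=> [_|i /stepL//]; split=> // d; rewrite L0; split.
    move=> [[Jd /(_ Jd)//|mda] NJd]; split=> // /(JE _ mda).
    by rewrite addrC subrK.
  move=> [mda Npos]; split; first by right.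
  by move: Npos; rewrite -JE // addrC subrK.
Qed.

End Filtration.

(** * Hilbert series *)

Section HilbertSeries.
Variable n : nat.
Implicit Types (D : expo n -> Prop) (a c : expo n) (p q : {poly int}).

(** [hilb] with the box size N decoupled from the degree d: one box serves all degrees up to N, as
    multiplying series requires. *)
Definition count_box N D d : nat :=
  #|[set v : {ffun 'I_n -> 'I_(N.*2.+1)} |
      `[< D (embed v) /\ deg1 (embed v) = d >]]|.

Lemma embed_inj N : injective (@embed n N).
Proof.
move=> v w /ffunP e; apply/ffunP => j; apply/val_inj.
by have := e j; rewrite !ffunE => /addIr[].
Qed.

Lemma embed_onto N c : (deg1 c <= N)%N ->
  exists v : {ffun 'I_n -> 'I_(N.*2.+1)}, embed v = c.
Proof.
move=> cN; exists [ffun j => inord `|(c j + N%:Z)%R|%N]; apply/ffunP => j.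
have : (`|c j| <= N)%N by apply: leq_trans cN; rewrite /deg1 (bigD1 j) //= leq_addr.
rewrite !ffunE => cj; rewrite inordK; move: (c j) cj => x; lia.
Qed.

Lemma count_box_indep N N' D d :
  (d <= N)%N -> (d <= N')%N -> count_box N D d = count_box N' D d.
Proof.
move=> dN dN'; rewrite /count_box !cardE.
rewrite -(size_map (@embed n N)) -[RHS](size_map (@embed n N')).
apply/perm_size/uniq_perm.
- by rewrite map_inj_uniq ?enum_uniq //; exact: embed_inj.
- by rewrite map_inj_uniq ?enum_uniq //; exact: embed_inj.
have memE M c : (d <= M)%N -> (c \in [seq embed v | v <-
    enum [set v : {ffun 'I_n -> 'I_(M.*2.+1)} |
      `[< D (embed v) /\ deg1 (embed v) = d >]]]) = `[< D c /\ deg1 c = d >].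
  move=> dM; apply/mapP/asboolP => [[v]|[Dc dc]].
    by rewrite mem_enum inE => /asboolP vP ->.
  have [|v vc] := @embed_onto M c; first by rewrite dc.
  by exists v => //; rewrite mem_enum inE vc; apply/asboolP.
by move=> c; rewrite !memE.
Qed.

Lemma hilb_box N D d : (d <= N)%N -> hilb D d = count_box N D d.
Proof. by move=> dN; rewrite -(@count_box_indep d N). Qed.

Lemma eq_hilb D D' d : (forall c, D c <-> D' c) -> hilb D d = hilb D' d.
Proof.
move=> DD'; apply: eq_card => v; rewrite !inE.
by apply: asbool_equiv_eq; rewrite DD'.
Qed.

Lemma hilb0 D d : (forall c, ~ D c) -> hilb D d = 0%N.
Proof.
move=> D0; apply: eq_card0 => v; rewrite !inE.
by apply/asboolP => -[/D0].
Qed.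

Lemma hilbU D D1 D2 d : (forall c, D c <-> D1 c \/ D2 c) ->
  (forall c, D1 c -> ~ D2 c) -> hilb D d = (hilb D1 d + hilb D2 d)%N.
Proof.
move=> DU disj; rewrite /hilb -cardsUI [X in (_ + X)%N]eq_card0 ?addn0.
  apply: eq_card => v; rewrite !inE; apply/asboolP/orP.
    by rewrite DU => -[[Dv|Dv] dv]; [left|right]; apply/asboolP.
  by case=> /asboolP[Dv dv]; split=> //; apply/DU; [left|right].
move=> v; rewrite !inE; apply/negP => /andP[/asboolP[D1v _] /asboolP[D2v _]].
exact: disj D1v D2v.
Qed.

(** Congruence modulo t^(N+1); series are compared through such truncations. *)
Definition eq_upto N p q : Prop := forall i, (i <= N)%N -> p`_i = q`_i.

Lemma eq_upto_mul N p p' q q' :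
  eq_upto N p p' -> eq_upto N q q' -> eq_upto N (p * q) (p' * q').
Proof.
move=> ep eq i iN; rewrite !coefM; apply: eq_bigr => j _.
have ji : (j <= i)%N by rewrite -ltnS.
by rewrite ep ?eq // (leq_trans _ iN) // leq_subr.
Qed.

Lemma eq_upto_prod N (T : finType) (F G : T -> {poly int}) :
  (forall i, eq_upto N (F i) (G i)) -> eq_upto N (\prod_i F i) (\prod_i G i).
Proof.
by move=> FG; elim/big_ind2: _ => // p p' q q'; exact: eq_upto_mul.
Qed.

Lemma ser_eqP p (H : nat -> nat) q :
  ser_eq p H q <-> forall N, eq_upto N (p * \poly_(i < N.+1) (H i)%:Z) q.
Proof.
have E m N : (m <= N)%N -> (p * \poly_(i < N.+1) (H i)%:Z)`_m =
    \sum_(k < m.+1) p`_k * (H (m - k)%N)%:Z.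
  move=> mN; rewrite coefM; apply: eq_bigr => k _.
  by rewrite coef_poly ltnS (leq_trans (leq_subr _ _) mN).
split=> [e N i iN|e m]; first by rewrite E.
by rewrite -(E m m) //; exact: e.
Qed.

Lemma ser_eq_mul (r : {poly int}) p H q : ser_eq p H q -> ser_eq (r * p) H (r * q).
Proof.
move=> /ser_eqP e; apply/ser_eqP => N; rewrite -mulrA.
by apply: eq_upto_mul => // i.
Qed.

Lemma ser_eq_sum p (r : nat) (H : nat -> nat -> nat) (q : nat -> {poly int}) :
  (forall i, (i < r)%N -> ser_eq p (H i) (q i)) ->
  ser_eq p (fun d => \sum_(i < r) H i d)%N (\sum_(i < r) q i).
Proof.
move=> e m; rewrite coef_sum; under [RHS]eq_bigr do rewrite -e //.
rewrite exchange_big; apply: eq_bigr => k _.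
by rewrite -mulr_sumr; congr (_ * _); rewrite (big_morph Posz PoszD (erefl _)).
Qed.

(* The truncation at [-N, N] of the generating function of B for |x|. *)
Definition gen_poly N (B : int -> bool) : {poly int} :=
  \sum_(x < N.*2.+1) if B (x%:Z - N%:Z) then 'X^`|x%:Z - N%:Z| else 0.

(** The absolute value d is attained at d and at -d; the guard [0 < d] avoids counting 0 twice. *)
Lemma coef_gen_poly N B d : (d <= N)%N ->
  (gen_poly N B)`_d = (B d%:Z)%:R + ((0 < d)%N && B (- d%:Z))%:R.
Proof.
move=> dN; rewrite coef_sum.
(* The index x stands for x - N, so d and -d sit at N + d and N - d. *)
have lt1 : (N + d < N.*2.+1)%N by lia.
have lt2 : (N - d < N.*2.+1)%N by lia.
have E (x : nat) : (if B (x%:Z - N%:Z) then 'X^`|x%:Z - N%:Z| else 0 : {poly int})`_d =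
    (B (x%:Z - N%:Z) && (d == `|x%:Z - N%:Z|%N))%:R.
  by case: ifP => _; rewrite ?coef0 // coefXn.
rewrite (bigD1 (Ordinal lt1)) //= E.
have -> : (N + d)%:Z - N%:Z = d%:Z by lia.
rewrite absz_nat eqxx andbT; congr (_ + _).
case: (posnP d) => [d0|d0] /=.
  rewrite big1 // => x /eqP xN; rewrite E; case: eqP => [e|]; last by rewrite andbF.
  by case: xN; apply/val_inj => /=; lia.
rewrite (bigD1 (Ordinal lt2)) /=; last by apply/eqP => -[]; lia.
rewrite E; have -> : (N - d)%:Z - N%:Z = - d%:Z by lia.
rewrite abszN absz_nat eqxx andbT big1 ?addr0 // => x /andP[/eqP x1 /eqP x2].
rewrite E; case: eqP => [e|]; last by rewrite andbF.
have [x1'|x2'] : (x : nat) = (N + d)%N \/ (x : nat) = (N - d)%N by lia.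
  by case: x1; exact/val_inj.
by case: x2; exact/val_inj.
Qed.

Lemma prod_monomials (T : finType) (b : pred T) (e : T -> nat) :
  \prod_i (if b i then 'X^(e i) else 0) =
  (if [forall i, b i] then 'X^(\sum_i e i)%N else 0) :> {poly int}.
Proof.
case: ifPn => [/forallP bT|].
  rewrite (eq_bigr (fun i => 'X^(e i))) => [|i _]; last by rewrite bT.
  by rewrite prodrXr.
rewrite negb_forall => /existsP[i /negPf bi].
by rewrite (bigD1 i) //= bi mul0r.
Qed.

(** Expanding the product chooses one entry per coordinate, that is a point of the box, and the
    exponents add up to its degree. *)
Lemma prod_gen_poly N (B : 'I_n -> int -> bool) d :
  (\prod_j gen_poly N (B j))`_d = (count_box N (fun c => forall j, B j (c j)) d)%:Z.
Proof.
rewrite bigA_distr_bigA coef_sum /count_box -sum1_card.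
rewrite [in RHS]big_mkcond /= (big_morph Posz PoszD (erefl _)).
apply: eq_bigr => v _; rewrite prod_monomials inE.
have -> : (\sum_i `|(v i)%:Z - N%:Z| = deg1 (embed v))%N.
  by apply: eq_bigr => j _; rewrite ffunE.
case: asboolP => [[Bv dv]|Nv]; last first.
  case: ifP => [/forallP Bv|_]; last by rewrite coef0.
  rewrite coefXn; case: eqP => // dv; case: Nv; split=> // j.
  by have := Bv j; rewrite ffunE.
rewrite ifT ?coefXn ?dv ?eqxx //; apply/forallP => j.
by have := Bv j; rewrite ffunE.
Qed.

(** * The Hilbert series of a single factor *)

Variable (A Z : {set 'I_n}) (a : expo n).
Hypotheses (ZA : Z \subset ~: A) (a_ge0 : forall j, 0 <= a j).
Hypothesis aA : forall j, j \in A -> a j = 0.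

(** Membership in the support of the factor splits by coordinate: fixed at a_j on Z, free on A, at
    least a_j elsewhere. Its series is therefore a product. *)
Definition in_cone j (x : int) : bool :=
  if j \in Z then x == a j else (j \in A) || (a j <= x).

Lemma in_coneP c :
  (forall j, in_cone j (c j)) <-> is_monom A (c - a) /\ ~ pos_on Z (c - a).
Proof.
split=> [B|[/is_monomP mca Npos] j].
  split.
    apply/is_monomP => j jA; have := B j; rewrite /in_cone !ffunE subr_ge0.
    by case: ifP => [_ /eqP->//|_]; rewrite (negPf jA).
  by case=> j jZ; have := B j; rewrite /in_cone jZ !ffunE => /eqP->; rewrite subrr ltxx.
rewrite /in_cone; case: ifPn => [jZ|jZ].
  have jA : j \notin A by rewrite -in_setC (subsetP ZA).
  have := mca j jA; rewrite !ffunE subr_ge0 => le.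
  rewrite eq_le le andbT leNgt; apply/negP => lt; apply: Npos.
  by exists j => //; rewrite !ffunE subr_gt0.
by case: (boolP (j \in A)) => //= /mca; rewrite !ffunE subr_ge0.
Qed.

(** The one-variable series are t^(a_j) on Z, 1 + 2t + 2t^2 + ... = (1 + t)/(1 - t) on A, and
    t^(a_j)/(1 - t) elsewhere. *)
Lemma local_factor N j :
  eq_upto N ((if j \in Z then 1 else 1 - 'X) * gen_poly N (in_cone j))
            ('X^`|a j| * (if j \in A then 1 + 'X else 1)).
Proof.
have aj := a_ge0 j; move=> i iN; rewrite /in_cone; have [jZ|jZ] := boolP (j \in Z).
  have /negPf -> : j \notin A by rewrite -in_setC (subsetP ZA).
  rewrite mul1r mulr1 coef_gen_poly // coefXn.
  by move: (a j) aj => x x0; do 2!case: eqP; case: posnP; lia.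
rewrite mulrBl mul1r coefB coefXM coef_gen_poly //.
have [jA|jA] := boolP (j \in A).
  rewrite (aA jA) mul1r coefD coef1 coefX /= !andbT.
  case: i iN => [|[|i]] iN //=; rewrite coef_gen_poly ?(ltnW iN) //=.
rewrite mulr1 coefXn /=; case: i iN => [|i] iN /=.
  by rewrite subr0; move: (a j) aj => x x0; case: eqP; case: leP; lia.
rewrite coef_gen_poly ?(ltnW iN) //.
by move: (a j) aj => x x0; case: eqP; do 4!case: leP; case: posnP; lia.
Qed.

Lemma ser_eq_cone (D : expo n -> Prop) :
    (forall c, D c <-> is_monom A (c - a) /\ ~ pos_on Z (c - a)) ->
  ser_eq ((1 - 'X) ^+ (n - #|Z|)) (hilb D) ('X^(deg1 a) * (1 + 'X) ^+ #|A|).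
Proof.
move=> DE m; pose G j := gen_poly m (in_cone j).
transitivity (((1 - 'X) ^+ (n - #|Z|) * \prod_j G j)`_m).
  rewrite coefM; apply: eq_bigr => k _; rewrite prod_gen_poly.
  rewrite -hilb_box ?leq_subr //; congr (_ * Posz _); apply: eq_hilb => c.
  by rewrite DE in_coneP.
have -> : (1 - 'X) ^+ (n - #|Z|) = \prod_j (if j \in Z then 1 else 1 - 'X) :> {poly int}.
  rewrite (bigID (mem Z)) /= big1 ?mul1r => [|j ->//].
  rewrite (eq_bigr (fun=> 1 - 'X)) => [|j /negPf->//].
  rewrite prodr_const; congr (_ ^+ _).
  transitivity #|~: Z|; first by rewrite cardsCs setCK card_ord.
  by apply: eq_card => j; rewrite !inE.
have -> : 'X^(deg1 a) * (1 + 'X) ^+ #|A| =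
    \prod_j ('X^`|a j| * (if j \in A then 1 + 'X else 1)) :> {poly int}.
  rewrite big_split /= prodrXr; congr (_ * _).
  by rewrite -big_mkcond prodr_const.
rewrite -big_split; apply: (eq_upto_prod (N := m)) => // j.
exact: local_factor.
Qed.

End HilbertSeries.

(** * The filtration of I/J *)

Section Dimension.
Variables (n : nat) (K : fieldType) (A : {set 'I_n}).

(** A chain above the larger ideal is also one above the smaller; if too long, it is truncated to
    length d + 1. *)
Lemma krull_dim_le (P P' : elt n K -> Prop) d d' : subI P P' ->
  krull_dim_quot A P d -> krull_dim_quot A P' d' -> (d' <= d)%N.
Proof.
move=> PP' [_ max_d] [[Q [P'Q prQ strQ]] _].
rewrite leqNgt; apply/negP => lt; apply: max_d.
exists Q; split=> [g Pg|i id1|i id1]; first exact/P'Q/PP'.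
  by apply: prQ; exact: leq_trans id1 lt.
by apply: strQ; exact: leq_trans id1 lt.
Qed.

Lemma krull_dim_uniq (P : elt n K -> Prop) d d' :
  krull_dim_quot A P d -> krull_dim_quot A P d' -> d = d'.
Proof.
have PP : subI P P by [].
by move=> kd kd'; apply/eqP; rewrite eqn_leq !(krull_dim_le PP).
Qed.

End Dimension.

Section Assembly.
Variables (n : nat) (K : fieldType) (A : {set 'I_n}).
Implicit Types (a b c : expo n) (g h : elt n K) (D U V : expo n -> Prop).

Lemma quot_suppE U V c : upset A U -> upset A V ->
  quot_supp K A U V c <-> U c /\ ~ V c.
Proof.
move=> uU uV; split=> [[_]|[Uc NVc]].
  by rewrite !gen_ideal_mono !upc_upset.
by split; rewrite ?gen_ideal_mono ?upc_upset //; case: uU => + _; apply.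
Qed.

Lemma quot_supp_upc I J c :
  quot_supp K A I J c <-> quot_supp K A (upc A I) (upc A J) c.
Proof.
split=> [[mc]|[mc]].
  by rewrite !gen_ideal_mono => Ic Jc; split;
    rewrite // gen_ideal_mono upc_upset //; exact: upset_upc.
rewrite !gen_ideal_mono !(upc_upset _ (upset_upc A _)) => Ic Jc.
by split; rewrite // gen_ideal_mono.
Qed.

Lemma shift_quot_suppE (Z : {set 'I_n}) a c : Z \subset ~: A ->
  shift_quot_supp K A (pos_on Z) a c <->
    is_monom A (c - a) /\ ~ pos_on Z (c - a).
Proof.
move=> ZA; rewrite /shift_quot_supp esubE gen_ideal_mono upc_pos_on //.
by split=> -[mc Npos]; split=> // pc; apply: Npos; [split|case: pc].
Qed.

Variables (I J : expo n -> Prop) (r : nat) (L : nat -> expo n -> Prop).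
Variables (Z : nat -> {set 'I_n}) (a : nat -> expo n).
Hypotheses (L0 : L 0%N = upc A J) (Lr : L r = upc A I).
Hypothesis upL : forall i, (i <= r)%N -> upset A (L i).
Hypothesis subL : forall i, (i < r)%N -> forall c, L i c -> L i.+1 c.
Hypothesis ZA : forall i, (i < r)%N -> Z i \subset ~: A.
Hypothesis stepL : forall i, (i < r)%N -> forall c,
  L i.+1 c /\ ~ L i c <-> is_monom A (c - a i) /\ ~ pos_on (Z i) (c - a i).

Lemma filtration_sub i c : (i <= r)%N -> L 0%N c -> L i c.
Proof. by elim: i => // i IH ir /(IH (ltnW ir)); exact: subL. Qed.

(** The monomial x^(a_i) lies in I. A monomial x^b of g outside the prime would make x^(a_i + b)
    nonzero in the factor, hence outside J, although g annihilates x^(a_i) modulo J. *)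
Lemma ann_sub_factor i : (i < r)%N ->
  subI (ann (K := K) A I J) (gen_ideal A (pos_on (Z i))).
Proof.
move=> ir g [sg annJ]; rewrite gen_idealP => b bg.
apply/(upc_pos_on _ (ZA ir)); split; first exact: sg.
apply: contrapT => Npos.
have [La _] : L i.+1 (a i) /\ ~ L i (a i).
  by apply/stepL => //; rewrite subrr; split; [exact: is_monom0|
    case=> j _; rewrite ffunE ltxx].
have [_ NLab] : L i.+1 (a i + b) /\ ~ L i (a i + b).
  by apply/stepL => //; rewrite [a i + b]addrC addrK; split=> //; exact: sg.
apply: NLab; apply: filtration_sub; first exact: ltnW.
have Ia : upc A I (a i).
  rewrite -Lr; suff up k : (i.+1 <= k <= r)%N -> L k (a i) by apply: up; rewrite ir /=.
  elim: k => // k IH /andP[]; rewrite ltnS leq_eqVlt => /predU1P[<-//|ik kr].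
  by apply: subL => //; apply: IH; rewrite ik ltnW.
have /annJ : gen_ideal A I (mono K (a i)) by apply/gen_ideal_mono.
rewrite etimes_mul gen_idealP L0; apply.
by rewrite mem_finsupp ecoefM_mono addrC addKr -mem_finsupp.
Qed.

(* Monomials x^(b_i) in P_i \ Q multiply M_i into M_(i-1), so their product
   annihilates I/J although it avoids the prime Q. *)
Lemma factor_below_prime Q : is_prime A Q -> subI (ann (K := K) A I J) Q ->
  exists2 i, (i < r)%N & subI (gen_ideal (K := K) A (pos_on (Z i))) Q.
Proof.
move=> prQ annQ; apply: contrapT => no.
have idQ := prime_ideal prQ.
have /choice[b bP] i : exists b, (i < r)%N ->
    [/\ is_monom A b, pos_on (Z i) b & ~ Q (mono K b)].
  have [ir|ri] := boolP (i < r)%N; last by exists 0.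
  apply: contrapT => nob; apply: no; exists i => // g gP.
  apply: gP => // c pc mc; apply: contrapT => NQ; apply: nob.
  by exists c.
pose s k := \sum_(i < k) b i.
have sS k : s k.+1 = s k + b k by rewrite /s big_ord_recr.
have ms k : (k <= r)%N -> is_monom A (s k).
  elim: k => [_|k IH kr]; first by rewrite /s big_ord0 is_monom0.
  by rewrite sS; apply: is_monomD; [exact/IH/ltnW|case: (bP k kr)].
have NQs k : (k <= r)%N -> ~ Q (mono K (s k)).
  elim: k => [_|k IH kr].
    by rewrite /s big_ord0 mono0; exact: prime_neq1 prQ.
  have [mb _ NQb] := bP k kr.
  rewrite sS monoD => /(prime_mul prQ) [||/(IH (ltnW kr))|/NQb] //.
    exact/Sf_mono/ms/ltnW.
  exact: Sf_mono.
have shrink k c : (k <= r)%N -> L k c -> L 0%N (c + s k).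
  elim: k c => [|k IH] c kr; first by rewrite /s big_ord0 addr0.
  have [mb [j jZ bj] _] := bP k kr; have [_ upk] := upL (ltnW kr).
  have [_ upk1] := upL kr => Lc; rewrite sS [s k + _]addrC addrA.
  apply: IH; first exact: ltnW.
  (* Were c + b_k outside [L k], both c and c + b_k would lie in the support of the factor; but b_k
     raises a coordinate in Z above its fixed value. *)
  apply: contrapT => NLcb.
  have NLc : ~ L k c by move=> Lkc; apply/NLcb/upk.
  have [/is_monomP mca _] : is_monom A (c - a k) /\ ~ pos_on (Z k) (c - a k).
    by apply/stepL.
  have [_] : is_monom A (c + b k - a k) /\ ~ pos_on (Z k) (c + b k - a k).
    by apply/stepL => //; split=> //; exact: upk1.
  apply; exists j => //; rewrite addrAC ffunE ltr_wpDl //.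
  by apply: mca; rewrite -in_setC (subsetP (ZA kr)).
apply: (NQs r) => //; apply: annQ; split; first exact/Sf_mono/ms.
move=> h; rewrite gen_idealP -Lr => Ih.
rewrite etimes_mul gen_idealP -L0 => c /supp_mul[_ [c' [/supp_mono-> c'h ->]]].
by rewrite addrC; apply: shrink => //; exact: Ih.
Qed.

(** The monomials of I/J are the disjoint union of those of the successive factors. *)
Lemma hilb_filtration d : hilb (quot_supp K A I J) d =
  (\sum_(i < r) hilb (shift_quot_supp K A (pos_on (Z i)) (a i)) d)%N.
Proof.
rewrite (eq_hilb _ (@quot_supp_upc I J)) -L0 -Lr.
suff main k : (k <= r)%N -> hilb (quot_supp K A (L k) (L 0%N)) d =
    (\sum_(i < k) hilb (shift_quot_supp K A (pos_on (Z i)) (a i)) d)%N.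
  exact: main.
elim: k => [_|k IH kr].
  by rewrite big_ord0; apply: hilb0 => c [].
have u0 := upL (leq0n r); have uk := upL (ltnW kr); have uk1 := upL kr.
rewrite big_ord_recr /= -(IH (ltnW kr)); apply: hilbU => c.
  rewrite !quot_suppE // shift_quot_suppE ?ZA // -stepL //.
  split=> [[Lc NL0c]|[[Lc NL0]|[Lc NLc]]].
  - by have [Lkc|NLkc] := pselect (L k c); [left|right].
  - by split=> //; exact: subL.
  - by split=> // /(filtration_sub (ltnW kr)).
by rewrite quot_suppE // shift_quot_suppE ?ZA // -stepL // => -[Lc _] [].
Qed.

End Assembly.

Theorem theorem6p3 (n : nat) (K : fieldType) (A : {set 'I_n})
    (I J : expo n -> Prop) :
  subI (gen_ideal (K:=K) A J) (gen_ideal (K:=K) A I) ->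
  exists (r : nat) (L P : nat -> expo n -> Prop) (a : nat -> expo n),
    (* filtration 0 = M_0 <= M_1 <= ... <= M_r = I/J, M_i = L_i/J *)
    [/\ eqI (gen_ideal (K:=K) A (L 0%N)) (gen_ideal A J),
        eqI (gen_ideal (K:=K) A (L r)) (gen_ideal A I) &
        forall i, (i < r)%N ->
          subI (gen_ideal (K:=K) A (L i)) (gen_ideal A (L i.+1))]
    /\
    (* M_i/M_{i-1} = (S_f/P_i)(-a_i), P_i graded prime, a_i in N^n, a_i(A) = 0 *)
    (forall i, (0 < i <= r)%N ->
       [/\ is_prime A (gen_ideal (K:=K) A (P i)),
           mon_iso K A (quot_supp K A (L i) (L i.-1))
                       (shift_quot_supp K A (P i) (a i)),
           forall j, 0 <= a i j &
           forall j, j \in A -> a i j = 0])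
    /\
    (* {P_1, ..., P_r} contains all minimal primes of I/J *)
    (forall Q, min_prime A I J Q ->
       exists2 i, (0 < i <= r)%N & eqI Q (gen_ideal (K:=K) A (P i)))
    /\
    (* H_{I/J}(t) = sum_i H_{(S_f/P_i)(-a_i)}(t) *)
    (forall d, hilb (quot_supp K A I J) d =
               (\sum_(1 <= i < r.+1) hilb (shift_quot_supp K A (P i) (a i)) d)%N)
    /\
    (* H_{(S_f/P_i)(-a_i)}(t) = Q_i(t) (1+t)^|A| / (1-t)^{d_i}, Q_i(1) = 1 *)
    (forall i, (0 < i <= r)%N ->
       exists di : nat,
         krull_dim_quot A (gen_ideal (K:=K) A (P i)) di /\
         exists Qi : {poly int},
           Qi.[1] = 1 /\
           ser_eq ((1 - 'X) ^+ di) (hilb (shift_quot_supp K A (P i) (a i)))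
                  (Qi * (1 + 'X) ^+ #|A|))
    /\
    (* H_{I/J}(t) = Q(t)/(1-t)^d, Q(1) = k 2^|A|, d = dim I/J *)
    (forall d : nat, krull_dim_quot A (ann (K:=K) A I J) d ->
       exists Q : {poly int},
         Q.[1] = (#|[set i : 'I_r |
                      `[< krull_dim_quot A (gen_ideal (K:=K) A (P i.+1)) d >] ]|
                  * 2 ^ #|A|)%:Z /\
         ser_eq ((1 - 'X) ^+ d) (hilb (quot_supp K A I J)) Q).
Proof.
move=> /subI_gen sJI.
have uI : upset A (upc A I) := upset_upc A I; have uJ : upset A (upc A J) := upset_upc A J.
have [r [L [Z [a [L0 Lr upL subL stepL]]]]] := prime_filtration uI uJ sJI.
have ZA i : (i < r)%N -> Z i \subset ~: A by move=> /stepL[].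
have stepE i : (i < r)%N -> forall c, L i.+1 c /\ ~ L i c <->
    is_monom A (c - a i) /\ ~ pos_on (Z i) (c - a i) by move=> /stepL[].
have dimP i : (i < r)%N ->
    krull_dim_quot A (gen_ideal (K := K) A (pos_on (Z i))) (n - #|Z i|).
  by move=> /ZA; exact: krull_dim_pos_on.
have series i : (i < r)%N -> ser_eq ((1 - 'X) ^+ (n - #|Z i|))
    (hilb (shift_quot_supp K A (pos_on (Z i)) (a i)))
    ('X^(deg1 (a i)) * (1 + 'X) ^+ #|A|).
  move=> ir; have [ZiA a0 aA _] := stepL i ir.
  apply: (ser_eq_cone ZiA a0 aA) => c; exact: shift_quot_suppE.
(* Factors are numbered from 1 in the statement and from 0 in the construction, hence the
   predecessors. *)
exists r, L, (fun i => pos_on (Z i.-1)), (fun i => a i.-1); split; last split;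
  last split; last split; last split.
- split=> [||i ir]; [rewrite L0|rewrite Lr|].
  + by apply: eqI_gen => c; exact: upc_upset.
  + by apply: eqI_gen => c; exact: upc_upset.
  + apply/subI_gen => c /(upc_upset _ (upL i (ltnW ir)))/(subL i ir).
    by move=> Lc; apply/(upc_upset _ (upL _ ir)).
- case=> // i /= ir; have [ZiA a0 aA _] := stepL i ir; split=> //.
    exact: pos_on_prime.
  (* Source and target have the same support, so every scalar can be 1. *)
  exists (fun=> 1); split=> // [c|c _]; last exact: oner_neq0.
  rewrite (quot_suppE _ _ (upL _ ir) (upL _ (ltnW ir))) stepE //.
  by apply: iff_sym; exact: shift_quot_suppE.
- move=> Q [prQ annQ minQ].
  (* Some factor prime lies below Q and contains the annihilator, so minimality makes it equal to
     Q. *)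
  have [i ir PQ] := factor_below_prime L0 Lr upL ZA stepE prQ annQ.
  exists i.+1 => //= g; split; last exact: PQ.
  apply: minQ => //; first exact/pos_on_prime/ZA.
  exact: (ann_sub_factor L0 Lr subL ZA stepE).
- move=> d; rewrite (hilb_filtration K L0 Lr upL subL ZA stepE).
  by rewrite big_add1 big_mkord.
- case=> // i /= ir; exists (n - #|Z i|)%N; split; first exact: dimP.
  exists 'X^(deg1 (a i)); split; first by rewrite hornerXn expr1n.
  exact: series.
- move=> d dimd; pose e i := (n - #|Z i|)%N.
  have le_e i : (i < r)%N -> (e i <= d)%N.
    move=> ir; apply: krull_dim_le dimd (dimP i ir).
    exact: (ann_sub_factor L0 Lr subL ZA stepE).
  (* Each factor is brought to the common denominator (1 - t)^d; at t = 1 only those of dimension d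
     survive, each contributing 2^|A|. *)
  exists (\sum_(i < r) (1 - 'X) ^+ (d - e i) *
            ('X^(deg1 (a i)) * (1 + 'X) ^+ #|A|)); split.
    rewrite horner_sum; set S := [set i | _].
    rewrite -[#|S|]sum1_card [in RHS]big_mkcond /= big_distrl /=.
    rewrite (big_morph Posz PoszD (erefl _)).
    apply: eq_bigr => i _; rewrite !hornerE /= subrr expr1n mulr1 inE.
    case: asboolP => [dimi|Ndim].
      rewrite (krull_dim_uniq dimi (dimP i (ltn_ord i))) subnn expr0.
      by rewrite mul1r mul1n -natz natrX.
    have lt : (0 < d - e i)%N.
      rewrite subn_gt0 ltn_neqAle le_e // andbT; apply/eqP => ed; apply: Ndim.
      by rewrite -ed; exact: dimP (ltn_ord i).
    by rewrite expr0n (gtn_eqF lt) mul0r mul0n.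
  have -> : hilb (quot_supp K A I J) = fun d =>
      (\sum_(i < r) hilb (shift_quot_supp K A (pos_on (Z i)) (a i)) d)%N.
    apply/funext => k; exact: (hilb_filtration K L0 Lr upL subL ZA stepE).
  apply: (ser_eq_sum (H := fun i => hilb (shift_quot_supp K A (pos_on (Z i)) (a i)))
    (q := fun i => (1 - 'X) ^+ (d - e i) * ('X^(deg1 (a i)) * (1 + 'X) ^+ #|A|))).
  move=> i ir; rewrite -{1}(subnK (le_e i ir)) exprD.
  exact/ser_eq_mul/series.
Qed.
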